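(* Fix $\Delta>0$. The probability that a run of the protocol $\mathrm{PA\text{-}CORE}(\Delta)$ is correct is at least $\Psi(n)\cdot\left(1-e^{-0.5\lambda\Delta}\right)^{(n+1)^2}$, where $$\Psi(n)=\max\left\{0,\ 1-\left(1-\frac{\ln n}{2\sqrt n}\right)^{2n}n^{1+\sqrt n}-\left(1+\frac{\ln n}{2\sqrt n}\right)^{2n}n^{1-\sqrt n}\right\}.$$
   Context: Setting: a supervisor $i_0$ and $n+1$ worker agents $i_1,\ldots,i_{n+1}$, connected by a complete reliable network; each message's delay is an independent exponential random variable with parameter $\lambda$. There is no global clock: each agent $i_k$ has a local clock $C_{i_k}(t)$ that measures elapsed time accurately but may be offset by an unknown constant; $C_{i_0}(t)=t$, and $i_0$ receives an external input at time $t=0$. Let $\delta=\frac{\ln n}{\lambda\sqrt n}$. Protocol $\mathrm{PA\text{-}CORE}(\Delta)$: at time $0$, $i_0$ sends ''trigger'' to all workers. Upon receiving ''trigger'', a worker sends ''redirect'' to each of the other $n$ workers. Each worker $i_k$ records its local clock readings $\tau_1,\ldots,\tau_n$ at the arrivals of the $n$ ''redirect'' messages it receives; upon the $n$-th one it computes $T=\frac1n\sum_{m=1}^n\tau_m-\frac{2}{\lambda}$, defines the adjusted clock $C^{Adj}_{i_k}(t)=C_{i_k}(t)-T$, waits until $C^{Adj}_{i_k}(t)\ge \Delta+2\delta(k-1)$ (not waiting if this already holds), and performs its action $\alpha_k$. With $t_k$ the time at which $i_k$ performs $\alpha_k$, a run is correct if $t_1\le t_2\le\cdots\le t_{n+1}<\infty$.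 *)

(* Defs.v *)
From HB Require Import structures.
From mathcomp Require Import all_boot all_order all_algebra.
From mathcomp Require Import all_classical all_reals all_analysis.
Set Implicit Arguments. Unset Strict Implicit. Unset Printing Implicit Defensive.
Import Order.TTheory GRing.Theory Num.Theory.
Local Open Scope classical_set_scope.
Local Open Scope ring_scope.

Section PACore.
Variable R : realType.

Definition pa_delta (lam : R) (n : nat) : R :=
  ln (n%:R) / (lam * Num.sqrt (n%:R)).

Definition Psi (n : nat) : R :=
  Num.max 0
    (1 - (1 - ln (n%:R) / (2 * Num.sqrt (n%:R))) ^+ (2 * n)
           * (n%:R `^ (1 + Num.sqrt (n%:R)))
       - (1 + ln (n%:R) / (2 * Num.sqrt (n%:R))) ^+ (2 * n)
           * (n%:R `^ (1 - Num.sqrt (n%:R)))).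

(** One run of PA-CORE(Delta), with n+1 workers indexed by 'I_n.+1
    (ordinal k stands for worker i_{k+1}).  Inputs:
    - c k   : offset of the local clock of worker k, C_k(t) = t + c k
              (the supervisor's clock is C(t) = t, trigger sent at t = 0);
    - dtr k : delay of the "trigger" message from the supervisor to worker k;
    - dre j k : delay of the "redirect" message from worker j to worker k
                (only used for j <> k).  All times below are real times. *)
Section Run.
Variables (n : nat) (lam Delta : R) (c : 'I_n.+1 -> R)
          (dtr : 'I_n.+1 -> R) (dre : 'I_n.+1 -> 'I_n.+1 -> R).

(** real time at which worker k receives the redirect sent by worker j:
    j receives the trigger at time dtr j and immediately sends "redirect". *)
Definition redirect_arrival (j k : 'I_n.+1) : R := dtr j + dre j k.

Definition local_reading (j k : 'I_n.+1) : R := redirect_arrival j k + c k.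

Definition pa_T (k : 'I_n.+1) : R :=
  (n%:R)^-1 * (\sum_(j < n.+1 | j != k) local_reading j k) - 2 / lam.

Definition adj_clock (k : 'I_n.+1) (t : R) : R := (t + c k) - pa_T k.

(** the real time from which adj_clock k t >= Delta + 2 delta k holds *)
Definition pa_threshold (k : 'I_n.+1) : R :=
  pa_T k - c k + Delta + 2 * pa_delta lam n * (k%:R).

(** time t_k of action alpha_k: worker k starts waiting upon the last
    (n-th) redirect arrival and acts as soon as its adjusted clock reaches
    Delta + 2 delta (k-1) (paper indexing), i.e. at
    max (last arrival, threshold). *)
Definition action_time (k : 'I_n.+1) : R :=
  \big[Num.max/pa_threshold k]_(j < n.+1 | j != k) redirect_arrival j k.

Definition pa_correct : Prop :=
  forall i j : 'I_n.+1, (i <= j)%N -> action_time i <= action_time j.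

End Run.

Section Prob.
Context {d : measure_display} {T : measurableType d}.
Variable P : probability T R.

Definition exp_distributed (X : T -> R) (lam : R) : Prop :=
  forall A : set R, measurable A -> P (X @^-1` A) = exponential_prob lam A.

Definition mutually_independent (I : finType) (X : I -> T -> R) : Prop :=
  forall B : I -> set R, (forall i, measurable (B i)) ->
    P (\bigcap_(i in [set: I]) (X i @^-1` B i)) =
    (\prod_(i : I) P (X i @^-1` B i))%E.

End Prob.

(** index type of all messages between agents: triggers to each worker,
    and redirects between distinct workers *)
Definition msg_index (n : nat) : finType :=
  ('I_n.+1 + {p : 'I_n.+1 * 'I_n.+1 | p.1 != p.2})%type.

Definition delay_family {n : nat} {A : Type} (dtr : 'I_n.+1 -> A)
  (dre : 'I_n.+1 -> 'I_n.+1 -> A) (m : msg_index n) : A :=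
  match m with
  | inl k => dtr k
  | inr p => dre (val p).1 (val p).2
  end.

End PACore.

(* Main.v *)
(** Write [arr j k] for the arrival time at worker [k] of the redirect sent by
[j], and [S_k] for the mean of the [arr j k] minus [2 / lam]; worker [k] acts at
the maximum of its arrivals and of [S_k + Delta + 2 delta k].  Bounding each
[S_k] conditionally on all delays being at most [Delta / 2] does not work: the
conditioning makes the lower tail of [S_k] heavier.  The differences
[S_k - S_l] behave better, since truncating two independent exponentials [X], [Y]
to a common interval only decreases the exponential moments of [X - Y].
Chernoff's bound then gives [S_k - S_l <= 2 delta] for all [k], [l] with
conditional probability at least [Psi n], on every event of the form "all triggers
take at most [b1] and all redirects at most [b2]".  On that event the thresholds
are ordered, and it remains to order the arrivals.  Let
[eta = exp (- lam Delta / 2)] and [m = n + 1].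
- If [(1 - eta) ^ m <= 1 / m], no truncation is made: the pairs
  ([S_k], last arrival at [k]) are exchangeable in [k], so the workers are in
  sorted order with probability at least [Psi n / m!], and [m! <= m ^ m].
- Otherwise [eta] is small, and [b1], [b2] are chosen with
  [b1 + b2 = Delta - 2 / lam], which is below every threshold because the means
  are nonnegative.  Allowing the many redirects a larger delay than the few
  triggers makes this event at least as likely as [(1 - eta) ^ (m ^ 2)]. *)

Require Import Defs.
From HB Require Import structures.
From mathcomp Require Import all_boot all_order all_algebra finmap perm.
From mathcomp Require Import all_classical all_reals all_analysis.
From mathcomp Require Import measurable_realfun simple_functions.
From mathcomp Require Import ring lra.
Import Order.TTheory GRing.Theory Num.Theory.
Local Open Scope classical_set_scope.
Local Open Scope ring_scope.

(** * Products of independent random variables *)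

Section ge0_integral_ext.
Local Open Scope ereal_scope.
Context d (T : measurableType d) (R : realType) (m : {measure set T -> \bar R}).
Variables (g X : T -> R).
Hypotheses (mg : measurable_fun setT g) (g0 : forall w, (0 <= g w)%R).
Hypothesis (mX : measurable_fun setT X).

Import HBNNSimple.

Lemma nnsfun_range_ge0 (h : {nnsfun R >-> R}) (i : 'I_#|` fset_set (range h)|) :
  (0 <= (fset_set (range h))`_i)%R.
Proof.
have : (fset_set (range h))`_i \in fset_set (range h) by apply: mem_nth.
by rewrite in_fset_set// inE => -[x _ <-].
Qed.

Lemma integral_mul_nnsfun_comp (h : {nnsfun R >-> R})
    (s := fset_set (range h)) :
  \int[m]_w (g w * h (X w))%:E =
  \sum_(i < #|` s|) (s`_i)%:E * \int[m]_w (g w * \1_(h @^-1` [set s`_i]) (X w))%:E.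
Proof.
have mi (i : 'I_#|` s|) :
    measurable_fun setT (fun w => g w * \1_(h @^-1` [set s`_i]) (X w))%R.
  apply: measurable_funM => //; apply: (measurableT_comp _ mX).
  exact: measurable_indic.
transitivity (\int[m]_w \sum_(i < #|` s|)
    ((s`_i)%:E * (g w * \1_(h @^-1` [set s`_i]) (X w))%:E)).
  apply: eq_integral => w _; rewrite fimfunEord mulr_sumr -sumEFin.
  by apply: eq_bigr => i _; rewrite -EFinM mulrCA.
rewrite ge0_integral_sum//.
- apply: eq_bigr => i _; rewrite ge0_integralZl ?lee_fin ?nnsfun_range_ge0//.
  + exact/measurable_EFinP.
  + by move=> w _; rewrite lee_fin mulr_ge0.
- by move=> i; apply: measurable_funeM; exact/measurable_EFinP.
- by move=> i w _; rewrite -EFinM lee_fin mulr_ge0 ?nnsfun_range_ge0 ?mulr_ge0.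
Qed.

Lemma cvg_integral_mul_nnsfun_comp (f : R -> R) (mf : measurable_fun setT f)
    (mf' := (measurable_EFinP _ _).2 mf) :
  (forall x, 0 <= f x)%R ->
  \int[m]_w (g w * nnsfun_approx measurableT mf' n (X w))%:E @[n --> \oo] -->
  \int[m]_w (g w * f (X w))%:E.
Proof.
move=> f0.
rewrite (_ : \int[m]_w (g w * f (X w))%:E = \int[m]_w (limn (fun n =>
    (g w * nnsfun_approx measurableT mf' n (X w))%:E))).
  apply: cvg_monotone_convergence => //.
  - move=> n; apply/measurable_EFinP/measurable_funM => //.
    exact: measurableT_comp.
  - by move=> n w _; rewrite lee_fin mulr_ge0.
  - move=> w _ a b ab; rewrite lee_fin ler_wpM2l//.
    exact/lefP/nd_nnsfun_approx.
apply: eq_integral => w _; apply/esym/cvg_lim => //.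
under eq_fun do rewrite EFinM.
rewrite EFinM; apply: cvgeZl => //.
by apply: (@cvg_nnsfun_approx _ _ _ _ measurableT _ mf') => // x _; rewrite lee_fin.
Qed.

End ge0_integral_ext.

Section ge0_integral_comp_indic_ext.
Import HBNNSimple.

(* An identity between integrals that holds for indicators extends to all
   nonnegative measurable functions, by monotone approximation. *)
Lemma ge0_integral_comp_indic_ext {d1 d2} {T1 : measurableType d1}
    {T2 : measurableType d2} {R : realType} (m1 : {measure set T1 -> \bar R})
    (m2 : {measure set T2 -> \bar R}) (g1 X1 : T1 -> R) (g2 X2 : T2 -> R)
    (C : R) :
  measurable_fun setT g1 -> (forall w, 0 <= g1 w) -> measurable_fun setT X1 ->
  measurable_fun setT g2 -> (forall w, 0 <= g2 w) -> measurable_fun setT X2 ->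
  (forall A, measurable A -> \int[m1]_w (g1 w * \1_A (X1 w))%:E =
                      C%:E * \int[m2]_w (g2 w * \1_A (X2 w))%:E)%E ->
  forall f : R -> R, measurable_fun setT f -> (forall x, 0 <= f x) ->
  (\int[m1]_w (g1 w * f (X1 w))%:E = C%:E * \int[m2]_w (g2 w * f (X2 w))%:E)%E.
Proof.
move=> mg1 g10 mX1 mg2 g20 mX2 H f mf f0.
have c1 := cvg_integral_mul_nnsfun_comp _ _ _ m1 _ _ mg1 g10 mX1 _ mf f0.
have c2 := cvg_integral_mul_nnsfun_comp _ _ _ m2 _ _ mg2 g20 mX2 _ mf f0.
rewrite -(cvg_lim _ c1)// -(cvg_lim _ c2)// -limeMl//; last first.
  by apply/cvg_ex; eexists; exact: c2.
congr (limn _); apply/funext => n /=.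
rewrite !integral_mul_nnsfun_comp// ge0_sume_distrr; last first.
  move=> i _; rewrite mule_ge0 ?lee_fin ?nnsfun_range_ge0//.
  by apply: integral_ge0 => w _; rewrite lee_fin mulr_ge0.
apply: eq_bigr => i _; rewrite H; last exact: measurable_funPTI.
by rewrite muleCA.
Qed.

End ge0_integral_comp_indic_ext.

Lemma prod_indic {R : realType} {T : Type} {I : finType} (A : I -> set T) (w : T) :
  \prod_(i : I) (\1_(A i) w : R) = \1_(\bigcap_(i in [set: I]) A i) w.
Proof.
have [Aw|Aw] := boolP (w \in \bigcap_(i in [set: I]) A i).
  rewrite indicE Aw big1// => i _; rewrite indicE mem_set//.
  by move: Aw; rewrite inE => /(_ i); exact.
rewrite indicE (negbTE Aw); move: Aw; rewrite notin_setE => /existsNP[i].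
move=> /not_implyP[_ nA].
by rewrite (bigD1 i)//= indicE memNset ?mul0r.
Qed.

Section independence.
Context {d} {T : measurableType d} {R : realType} (P : probability T R).
Context {I : finType} (X : I -> T -> R).
Hypothesis mX : forall i, measurable_fun setT (X i).
Hypothesis indep : mutually_independent P X.

Lemma mutually_independent_integral_prod_indic (J : {set I}) (f : I -> R -> R)
    (e : I -> R) :
  (forall i, measurable_fun setT (f i)) -> (forall i x, 0 <= f i x) ->
  (forall i, i \notin J -> exists2 A, measurable A & f i = \1_A) ->
  (forall i, \int[P]_w (f i (X i w))%:E = (e i)%:E)%E ->
  (\int[P]_w (\prod_i f i (X i w))%:E = (\prod_i e i)%:E)%E.
Proof.
have [k] := ubnP #|J|; elim: k => // k IH in J f e *.
move=> Jk mf f0 fA fe.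
have [J0|[i iJ]] := set_0Vmem J.
  have /choice[A Af] i : exists A, measurable A /\ f i = \1_A.
    by have [|A mA fiA] := fA i; [rewrite J0 inE|exists A].
  transitivity (\int[P]_w (\1_(\bigcap_(i in [set: I]) (X i @^-1` A i)) w)%:E)%E.
    apply: eq_integral => w _; rewrite -prod_indic.
    by congr EFin; apply: eq_bigr => i _; rewrite (Af i).2.
  have mXA i : measurable (X i @^-1` A i).
    by rewrite -[X in measurable X]setTI; apply: mX => //; have [] := Af i.
  rewrite integral_indic//; last exact: fin_bigcap_measurable.
  rewrite setIT; transitivity (\prod_i P (X i @^-1` A i))%E.
    by apply: indep => i; have [] := Af i.
  rewrite -prodEFin; apply: eq_bigr => i _; rewrite -fe (Af i).2.
  under eq_integral do rewrite -[\1_(A i) (X i _)]/(\1_(X i @^-1` A i) _).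
  by rewrite integral_indic// setIT.
have e0 j : 0 <= e j.
  by rewrite -lee_fin -fe integral_ge0// => w _; rewrite lee_fin.
transitivity (\int[P]_w ((\prod_(j | j != i) f j (X j w)) * f i (X i w))%:E)%E.
  by apply: eq_integral => w _; rewrite (bigD1 i)//= mulrC.
rewrite (@ge0_integral_comp_indic_ext _ _ _ _ _ P P _ _ (cst 1) (X i)
  (\prod_(j | j != i) e j))//.
- under eq_integral do rewrite /= mul1r.
  by rewrite fe -EFinM [in RHS](bigD1 i)//= mulrC.
- under eq_fun do rewrite -big_filter.
  by apply: measurable_prod => j _; exact: measurableT_comp.
- by move=> w; rewrite prodr_ge0.
move=> A mA.
pose f' j := if j == i then \1_A : R -> R else f j.
pose e' j := if j == i then fine (P (X i @^-1` A)) else e j.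
have mXA : measurable (X i @^-1` A).
  by rewrite -[X in measurable X]setTI; exact: mX.
have PXA : (\int[P]_w (\1_A (X i w))%:E = (fine (P (X i @^-1` A)))%:E)%E.
  rewrite fineK ?fin_num_measure// -[in RHS](setIT (_ @^-1` _)) -integral_indic//.
have -> : (\int[P]_w ((\prod_(j | j != i) f j (X j w)) * \1_A (X i w))%:E =
    \int[P]_w (\prod_j f' j (X j w))%:E)%E.
  apply: eq_integral => w _; rewrite [in RHS](bigD1 i)//= {1}/f' eqxx mulrC.
  by congr (_ * _)%:E; apply: eq_bigr => j /negbTE ji; rewrite /f' ji.
rewrite (IH (J :\ i)%SET f' e').
- rewrite (bigD1 i)//= {1}/e' eqxx mulrC EFinM.
  under [in RHS]eq_integral do rewrite /= mul1r.
  rewrite PXA; congr (_%:E * _)%E.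
  by apply: eq_bigr => j /negbTE ji; rewrite /e' ji.
- by move: Jk; rewrite (cardsD1 i) iJ.
- by move=> j; rewrite /f'; case: ifP => _.
- by move=> j x; rewrite /f'; case: ifP => _.
- move=> j; rewrite !inE /f'; case: eqVneq => [_ _|_ /=]; first by exists A.
  exact: fA.
- by move=> j; rewrite /f' /e'; case: eqVneq => [->|_].
Qed.

Lemma mutually_independent_integral_prod (f : I -> R -> R) (e : I -> R) :
  (forall i, measurable_fun setT (f i)) -> (forall i x, 0 <= f i x) ->
  (forall i, \int[P]_w (f i (X i w))%:E = (e i)%:E)%E ->
  (\int[P]_w (\prod_i f i (X i w))%:E = (\prod_i e i)%:E)%E.
Proof.
move=> mf f0 fe.
apply: (mutually_independent_integral_prod_indic [set: I]%SET) => // i.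
by rewrite inE.
Qed.

End independence.

Lemma integral_mul_indic {d} {T : measurableType d} {R : realType}
    (m : {measure set T -> \bar R}) (g : T -> R) (A : set T) :
  (\int[m]_w (g w * \1_A w)%:E = \int[m]_(w in A) (g w)%:E)%E.
Proof.
rewrite [RHS]integral_mkcond; apply: eq_integral => w _.
by rewrite patchE indicE; case: ifPn => _; rewrite ?mulr1 ?mulr0.
Qed.

Section exponential_moments.
Context {d} {T : measurableType d} {R : realType} (P : probability T R).

Lemma exponential_pdf_tilt (lam s x : R) : 0 < lam -> s < lam ->
  exponential_pdf lam x * expR (s * x) =
  lam / (lam - s) * exponential_pdf (lam - s) x.
Proof.
move=> lam0 slam; have [x0|x0] := ltP x 0.
  by rewrite !lt0_exponential_pdf// mul0r mulr0.
rewrite !exponential_pdfE// mulrA divfK ?subr_eq0 ?gt_eqF// -mulrA -expRD.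
by congr (_ * expR _); ring.
Qed.

Lemma exp_distributed_integral (X : T -> R) (lam : R) (f : R -> R) :
  0 < lam -> measurable_fun setT X -> exp_distributed P X lam ->
  measurable_fun setT f -> (forall x, 0 <= f x) ->
  (\int[P]_w (f (X w))%:E =
   \int[lebesgue_measure]_x (exponential_pdf lam x * f x)%:E)%E.
Proof.
move=> lam0 mX PX mf f0.
transitivity (\int[P]_w (cst 1 w * f (X w))%:E)%E.
  by apply: eq_integral => w _; rewrite mul1r.
rewrite (@ge0_integral_comp_indic_ext _ _ _ _ _ P lebesgue_measure _ _
  (exponential_pdf lam) id 1) ?mul1e//.
- exact: measurable_exponential_pdf.
- by move=> x; rewrite exponential_pdf_ge0 ?ltW.
move=> A mA; rewrite mul1e [RHS]integral_mul_indic.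
have mXA : measurable (X @^-1` A) by rewrite -[X in measurable X]setTI; exact: mX.
transitivity (\int[P]_w (\1_(X @^-1` A) w)%:E)%E.
  by apply: eq_integral => w _; rewrite mul1r.
by rewrite integral_indic// setIT; exact: PX.
Qed.

Lemma exp_distributed_mgf (X : T -> R) (lam s : R) (A : set R) :
  0 < lam -> s < lam -> measurable_fun setT X -> exp_distributed P X lam ->
  measurable A ->
  (\int[P]_w (\1_A (X w) * expR (s * X w))%:E =
   (lam / (lam - s))%:E * exponential_prob (lam - s) A)%E.
Proof.
move=> lam0 slam mX PX mA.
have ls0 : 0 < lam - s by rewrite subr_gt0.
rewrite (@exp_distributed_integral X lam (fun x => \1_A x * expR (s * x)))//.
- rewrite /exponential_prob -[in RHS]integral_mul_indic -ge0_integralZl_EFin//.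
  + apply: eq_integral => x _; congr EFin.
    by rewrite mulrCA exponential_pdf_tilt// mulrC mulrA.
  + by move=> x _; rewrite lee_fin mulr_ge0// exponential_pdf_ge0// ltW.
  + apply/measurable_EFinP/measurable_funM.
      exact: measurable_exponential_pdf.
    exact: measurable_indic.
  + by rewrite divr_ge0 ?ltW.
- apply: measurable_funM; first exact: measurable_indic.
  by apply: measurableT_comp => //; exact: measurable_funM.
Qed.

Lemma exponential_prob_fin_num (r : R) (A : set R) : 0 < r -> measurable A ->
  exponential_prob r A \is a fin_num.
Proof.
move=> r0 mA; have pdf0 x : (0 <= (exponential_pdf r x)%:E)%E.
  by rewrite lee_fin exponential_pdf_ge0// ltW.
rewrite ge0_fin_numE; last by rewrite integral_ge0// => x _; exact: pdf0.
apply: (@le_lt_trans _ _ (exponential_prob r setT)).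
  apply: ge0_subset_integral => //.
  by apply/measurable_EFinP; exact: measurable_exponential_pdf.
by rewrite /exponential_prob integral_exponential_pdf// ltry.
Qed.

Definition truncated_mgf (lam : R) (A : set R) (s : R) : R :=
  lam / (lam - s) * fine (exponential_prob (lam - s) A).

Lemma truncated_mgfE (X : T -> R) (lam s : R) (A : set R) :
  0 < lam -> s < lam -> measurable_fun setT X -> exp_distributed P X lam ->
  measurable A ->
  (\int[P]_w (\1_A (X w) * expR (s * X w))%:E = (truncated_mgf lam A s)%:E)%E.
Proof.
move=> lam0 slam mX PX mA; rewrite (exp_distributed_mgf _ _ _ _ lam0 slam mX PX mA).
rewrite /truncated_mgf [in RHS]EFinM fineK//.
by rewrite exponential_prob_fin_num// subr_gt0.
Qed.

Lemma truncated_mgf_ge0 (lam s : R) (A : set R) :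
  0 < lam -> s < lam -> 0 <= truncated_mgf lam A s.
Proof.
move=> lam0 slam; rewrite mulr_ge0 ?divr_ge0 ?subr_ge0 ?(ltW lam0) ?(ltW slam)//.
rewrite fine_ge0// integral_ge0// => x _.
by rewrite lee_fin exponential_pdf_ge0// subr_ge0 ltW.
Qed.

End exponential_moments.

Section chernoff.
Context {d} {T : measurableType d} {R : realType} (P : probability T R).
Context {I : finType} (X : I -> T -> R) (lam : R).
Hypothesis lam0 : 0 < lam.
Hypothesis mX : forall i, measurable_fun setT (X i).
Hypothesis indep : mutually_independent P X.
Hypothesis expX : forall i, exp_distributed P (X i) lam.

Lemma chernoff_box (A : I -> set R) (s : I -> R) (t : R) (S : set T) :
  (forall i, measurable (A i)) -> (forall i, s i < lam) -> measurable S ->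
  (forall w, S w -> forall i, A i (X i w)) ->
  (forall w, S w -> t <= \sum_i s i * X i w) ->
  (P S <= (expR (- t) * \prod_i truncated_mgf lam (A i) (s i))%:E)%E.
Proof.
move=> mA slam mS SA St.
pose f i x := \1_(A i) x * expR (s i * x).
have mf i : measurable_fun setT (f i).
  apply: measurable_funM; first exact: measurable_indic.
  by apply: measurableT_comp => //; exact: measurable_funM.
have f0 i x : 0 <= f i x by rewrite mulr_ge0 ?expR_ge0.
rewrite EFinM.
rewrite -(@mutually_independent_integral_prod _ _ _ P _ X mX indep f)//; last first.
  by move=> i; exact: truncated_mgfE.
have mprod : measurable_fun setT (fun w => \prod_i f i (X i w)).
  by apply: measurable_prod => i _; exact: measurableT_comp.
have prod0 w : 0 <= \prod_i f i (X i w) by rewrite prodr_ge0.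
have mprodE : measurable_fun setT (fun w => (\prod_i f i (X i w))%:E).
  exact/measurable_EFinP.
have prodE0 w : [set: T] w -> (0 <= (\prod_i f i (X i w))%:E)%E.
  by rewrite lee_fin.
rewrite -(ge0_integralZl_EFin _ measurableT prodE0 mprodE (expR_ge0 _)).
rewrite -[leLHS]/(P S) -[in leLHS](setIT S) -integral_indic//.
apply: ge0_le_integral => //.
- by apply/measurable_EFinP; exact: measurable_indic.
- by apply: measurable_funeM; exact/measurable_EFinP.
move=> w _; rewrite -EFinM lee_fin indicE.
have [Sw|nSw] := boolP (w \in S); last by rewrite mulr_ge0 ?expR_ge0.
move: Sw; rewrite inE => Sw; have tw := St _ Sw.
under eq_bigr do rewrite /f indicE (mem_set (SA _ Sw _)) mul1r.
by rewrite -expR_sum -expRD -[leLHS]/(1 : R) -(expR0 R) ler_expR; lra.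
Qed.

End chernoff.

(** * Numerical estimates *)

Section numerical_bounds.
Import numFieldNormedType.Exports.
Context {R : realType}.
Implicit Types x y t r : R.

Lemma expR_double_ge (a r s : R) : 0 <= r -> s <= r ^+ 2 -> r <= expR a ->
  s <= expR (a *+ 2).
Proof.
move=> r0 sr ra; apply: (le_trans sr).
by rewrite -mulr_natl expRM_natl; rewrite lerXn2r ?nnegrE ?expR_ge0.
Qed.

Lemma expR_9_4_ge9 : 9 <= expR (9 / 4) :> R.
Proof.
have -> : 9 / 4 = 9 / 256 *+ 2 *+ 2 *+ 2 *+ 2 *+ 2 *+ 2 :> R by field.
apply: (@expR_double_ge _ (3006 / 1000)); [lra|lra|].
apply: (@expR_double_ge _ (1734 / 1000)); [lra|lra|].
apply: (@expR_double_ge _ (1317 / 1000)); [lra|lra|].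
apply: (@expR_double_ge _ (1148 / 1000)); [lra|lra|].
apply: (@expR_double_ge _ (2143 / 2000)); [lra|lra|].
apply: (@expR_double_ge _ (265 / 256)); [lra|lra|].
by apply: le_trans (expR_ge1Dx _); lra.
Qed.

Lemma expR1_ge_5_2 : 5 / 2 <= expR 1 :> R.
Proof.
have -> : 1 = 1 / 8 *+ 2 *+ 2 *+ 2 :> R by field.
apply: (@expR_double_ge _ (8 / 5)); [lra|lra|].
apply: (@expR_double_ge _ (253 / 200)); [lra|lra|].
apply: (@expR_double_ge _ (9 / 8)); [lra|lra|].
by apply: le_trans (expR_ge1Dx _); lra.
Qed.

Lemma expR_le_1Dx (y : R) : 0 <= y <= 2 / 5 ->
  expR (y - y ^+ 2 / 2 + 23 / 100 * y ^+ 3) <= 1 + y.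
Proof.
move=> /andP[y0 y1].
have y10 : 0 < 1 + y by lra.
rewrite -ler_ln ?posrE ?expR_gt0// expRK -subr_ge0.
pose h : R -> R := @ln R \o (cst 1 + id) -
  (id - 2^-1 *: (id : R -> R) ^+ 2 + 23 / 100 *: (id : R -> R) ^+ 3).
have dh : forall t : R, -1 < t ->
    is_derive t 1 h ((1 + t)^-1 - (1 - t + 69 / 100 * t ^+ 2)).
  move=> t t1; have t10 : 0 < 1 + t by lra.
  have d1 : is_derive t 1 (@ln R \o (cst 1 + id) : R -> R) ((1 + t)^-1 * (0 + 1)).
    by apply: is_derive1_comp; exact: is_derive1_ln.
  have dX k : is_derive t 1 ((id : R -> R) ^+ k.+1) (k.+1%:R * t ^+ k *: 1).
    exact: is_deriveX.
  have -> : (1 + t)^-1 - (1 - t + 69 / 100 * t ^+ 2) =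
      (1 + t)^-1 * (0 + 1) - (1 - 2^-1 *: (2%:R * t ^+ 1 *: 1) +
        (23 / 100) *: (3%:R * t ^+ 2 *: 1)) :> R.
    by rewrite /GRing.scale/=; field; lra.
  have d2 := is_deriveB (is_derive_id t 1) (is_deriveZ 2^-1 (dX 1)).
  have d3 := is_deriveZ (23 / 100) (dX 2).
  exact: (is_deriveB d1 (is_deriveD d2 d3)).
have hc : {within `[0, y], continuous h}.
  apply: (@derivable_within_continuous _ _ h `[0, y]%R) => z.
  rewrite in_itv/= => /andP[z0 _]; by apply: ex_derive; apply: dh; lra.
have [|c] := @MVT_segment _ h (fun t => (1 + t)^-1 - (1 - t + 69 / 100 * t ^+ 2))
  0 y y0 _ hc.
  by move=> z; rewrite in_itv/= => /andP[z0 _]; apply: dh; lra.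
rewrite in_itv/= => /andP[c0 cy] hE.
have -> : ln (1 + y) - (y - y ^+ 2 / 2 + 23 / 100 * y ^+ 3) = h y - h 0.
  by rewrite /h/= !fctE/= addr0 ln1 /GRing.scale/=; ring.
rewrite hE subr0 mulr_ge0// subr_ge0.
have c10 : 0 < 1 + c by lra.
rewrite -[leRHS]mul1r ler_pdivlMr//.
have : 0 <= c ^+ 2 * (31 / 100 - 69 / 100 * c) by rewrite mulr_ge0 ?sqr_ge0//; lra.
by lra.
Qed.

Lemma expR1_le_11_4 : expR 1 <= 11 / 4 :> R.
Proof.
have := expR_le_1Dx (2 / 5); rewrite lexx andbT => /(_ ltac:(lra)) h.
set a : R := _ + _ in h.
apply: (@le_trans _ _ (expR a ^+ 3)).
  by rewrite -expRM_natl ler_expR /a; lra.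
apply: (@le_trans _ _ ((1 + 2 / 5) ^+ 3)); last lra.
by rewrite lerXn2r ?nnegrE ?expR_ge0//; lra.
Qed.

Lemma ln_le_tangent t r : 0 < t -> 0 < r -> ln t <= t / r + (ln r - 1).
Proof.
move=> t0 r0; have tr0 : 0 < t / r by rewrite divr_gt0.
have := @le_ln1Dx R (t / r - 1); rewrite subrKC ltrBrDl subrr.
by move=> /(_ tr0); rewrite ln_div//; lra.
Qed.

Lemma ln_le_of_expR t r : 0 < t -> t <= expR r -> ln t <= r.
Proof. by move=> t0 tr; rewrite -ler_expR lnK ?posrE. Qed.

Lemma ln_sqrt_nat (n : nat) : ln n%:R = 2 * ln (Num.sqrt n%:R) :> R.
Proof.
case: n => [|n]; first by rewrite sqrtr0 ln0// mulr0.
by rewrite mulr_natl -lnXn ?sqrtr_gt0// sqr_sqrtr.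
Qed.

Lemma ln_div_sqrt_le (n : nat) : (0 < n)%N ->
  ln n%:R / (2 * Num.sqrt n%:R) <= 2 / 5 :> R.
Proof.
move=> n0; have u0 : 0 < Num.sqrt n%:R :> R by rewrite sqrtr_gt0 ltr0n.
have h1 : ln (5 / 2) <= 1 :> R.
  apply: ln_le_of_expR; first lra.
  exact: expR1_ge_5_2.
have := ln_le_tangent _ (5 / 2) u0; rewrite ln_sqrt_nat ler_pdivrMr ?mulr_gt0//.
lra.
Qed.

End numerical_bounds.

Section tail_estimates.
Context {R : realType}.

Definition tail_ratio (n : nat) : R := ln n%:R / (2 * Num.sqrt n%:R).

(* Chernoff's bound for [S_k - S_l > 2 delta], with parameter
   [lam * tail_ratio n] for the [n.+1] pairs of delays in [n * (S_k - S_l)]. *)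
Definition pair_tail (n : nat) : R :=
  (1 - tail_ratio n ^+ 2) ^- n.+1 * expR (- (4 * n%:R * tail_ratio n ^+ 2)).

Lemma tail_ratio_bounds (n : nat) : (0 < n)%N -> 0 <= tail_ratio n <= 2 / 5.
Proof.
move=> n0; rewrite ln_div_sqrt_le// andbT divr_ge0 ?mulr_ge0 ?sqrtr_ge0//.
by rewrite ln_ge0// ler1n.
Qed.

Lemma ln_tail_ratio (n : nat) : (0 < n)%N ->
  ln n%:R = 2 * Num.sqrt n%:R * tail_ratio n.
Proof.
by move=> n0; rewrite mulrC divfK// mulf_neq0// gt_eqF// sqrtr_gt0 ltr0n.
Qed.

Lemma ln_sqr_tail_ratio (n : nat) : (0 < n)%N ->
  n%:R * tail_ratio n ^+ 2 = ln n%:R ^+ 2 / 4.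
Proof.
move=> n0; have u2 : Num.sqrt n%:R ^+ 2 = n%:R :> R by rewrite sqr_sqrtr.
by rewrite (ln_tail_ratio _ n0) !exprMn u2; lra.
Qed.

Lemma natr_powR (n : nat) (r : R) : (0 < n)%N ->
  n%:R `^ r = expR (r * ln n%:R) :> R.
Proof. by move=> n0; rewrite /powR pnatr_eq0 gtn_eqF. Qed.

Lemma upper_tail_lb (n : nat) (x := tail_ratio n) : (0 < n)%N ->
  expR (ln n%:R + 2 * n%:R * (23 / 100 * x ^+ 3 - x ^+ 2 / 2)) <=
  (1 + x) ^+ (2 * n) * n%:R `^ (1 - Num.sqrt n%:R).
Proof.
move=> n0; have xb := tail_ratio_bounds _ n0.
have u2 : Num.sqrt n%:R ^+ 2 = n%:R :> R by rewrite sqr_sqrtr.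
have := expR_le_1Dx _ xb; rewrite -/x => h.
apply: (@le_trans _ _ (expR (x - x ^+ 2 / 2 + 23 / 100 * x ^+ 3) ^+ (2 * n) *
   n%:R `^ (1 - Num.sqrt n%:R))).
  rewrite -expRM_natl natr_powR// -expRD ler_expR.
  have uL : Num.sqrt n%:R * ln n%:R = 2 * n%:R * x :> R.
    by rewrite (ln_tail_ratio _ n0) -/x -[in RHS]u2; ring.
  by rewrite natrM mulrBl mul1r uL; lra.
have /andP[x0 _] := xb.
by rewrite ler_pM2r ?powR_gt0 ?ltr0n// lerXn2r ?nnegrE ?expR_ge0 ?addr_ge0.
Qed.

Lemma Psi_gt0E (n : nat) (x := tail_ratio n) : 0 < Psi R n ->
  (1 + x) ^+ (2 * n) * n%:R `^ (1 - Num.sqrt n%:R) <= 1 - Psi R n.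
Proof.
rewrite /Psi lt_max ltxx/= => h; rewrite max_r; last exact: ltW.
have : 0 <= (1 - x) ^+ (2 * n) * n%:R `^ (1 + Num.sqrt n%:R).
  by rewrite mulr_ge0 ?powR_ge0// exprM exprn_ge0// sqr_ge0.
by rewrite /x /tail_ratio; lra.
Qed.

Lemma Psi_gt0_ln (n : nat) (x := tail_ratio n) : (0 < n)%N -> 0 < Psi R n ->
  4 < ln n%:R * (1 - 46 / 100 * x).
Proof.
move=> n0 P0; have := upper_tail_lb _ n0; rewrite -/x => /le_trans.
move=> /(_ _ (Psi_gt0E _ P0)) h.
have {h} : expR (ln n%:R + 2 * n%:R * (23 / 100 * x ^+ 3 - x ^+ 2 / 2)) < 1.
  by apply: (le_lt_trans h); lra.
rewrite expR_lt1.
have -> : 2 * n%:R * (23 / 100 * x ^+ 3 - x ^+ 2 / 2) =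
   n%:R * x ^+ 2 * (46 / 100 * x - 1) by field.
rewrite ln_sqr_tail_ratio// => h.
have L0 : 0 <= ln n%:R :> R by rewrite ln_ge0// ler1n.
rewrite -subr_gt0.
have : 0 < ln n%:R / 4 * (ln n%:R * (1 - 46 / 100 * x) - 4) by lra.
by rewrite pmulr_rgt0// ltNge; apply/negP => L1; move: h; have -> : ln n%:R = 0 :> R; lra.
Qed.

(* For smaller [n] the upper-tail term of [Psi] alone is at least [1]. *)
Lemma Psi_gt0_ge80 (n : nat) : (0 < n)%N -> 0 < Psi R n -> (80 <= n)%N.
Proof.
move=> n0 P0; rewrite leqNgt; apply/negP => n80.
have := Psi_gt0_ln _ n0 P0; rewrite ltNge => /negP; apply.
have n0R : 0 < n%:R :> R by rewrite ltr0n.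
have n79 : n%:R <= 79 :> R by rewrite ler_nat.
have L0 : 0 <= ln n%:R :> R by rewrite ln_ge0// ler1n.
have LU : ln n%:R <= 9 / 2 :> R.
  apply: ln_le_of_expR => //; apply: (le_trans n79).
  have -> : 9 / 2 = 9 / 4 *+ 2 :> R by field.
  by apply: (@expR_double_ge _ _ 9); [lra|lra|exact: expR_9_4_ge9].
have u0 : 0 < Num.sqrt n%:R :> R by rewrite sqrtr_gt0.
have uU : Num.sqrt n%:R <= 889 / 100 :> R.
  rewrite -[leRHS]ger0_norm; last lra.
  by rewrite -sqrtr_sqr ler_sqrt; lra.
have xL := ln_tail_ratio _ n0.
have /andP[x0 _] := tail_ratio_bounds _ n0.
move: (tail_ratio n) (Num.sqrt n%:R) (ln n%:R) xL x0 u0 uU LU L0 => x u L.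
move=> xL x0 u0 uU LU L0.
have xb : L <= 1778 / 100 * x by rewrite xL; nra.
have : L * L <= L * (1778 / 100 * x) by rewrite ler_wpM2l.
nra.
Qed.

Lemma pair_tail_le (n : nat) : (0 < n)%N -> 0 < Psi R n ->
  (n.+1 * n)%:R * pair_tail n <= 1 - Psi R n.
Proof.
move=> n0 P0; have n80 := Psi_gt0_ge80 _ n0 P0.
have n80R : 80 <= n%:R :> R by rewrite ler_nat.
have /andP[x0 x1] := tail_ratio_bounds _ n0.
have b1 := Psi_gt0E _ P0.
apply: (le_trans _ b1).
have := upper_tail_lb _ n0; rewrite expRD lnK ?posrE ?ltr0n// => b2.
move: b1 b2; set b := _ * _ `^ _; rewrite /pair_tail.
set x := tail_ratio n in x0 x1 * => b1 b2.
have x20 : 0 <= x ^+ 2 by rewrite sqr_ge0.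
have x2 : x ^+ 2 <= 4 / 25 by nra.
pose v := expR (- (n%:R * x ^+ 2 / 2)).
have v0 : 0 < v := expR_gt0 _.
have b3 : n%:R * v ^+ 2 <= b.
  apply: (le_trans _ b2); rewrite ler_wpM2l// -expRM_natl ler_expR.
  have : 0 <= n%:R * x ^+ 3 by rewrite mulr_ge0// exprn_ge0.
  lra.
have nv2 : n%:R * v ^+ 2 <= 1 by apply: (le_trans b3); lra.
have v8 : v <= 1 / 8.
  have : v ^+ 2 <= (1 / 8) ^+ 2.
    have : 80 * v ^+ 2 <= n%:R * v ^+ 2 by rewrite ler_wpM2r ?sqr_ge0.
    by move: nv2; lra.
  by move: v v0 {b3 nv2} => w w0 w2; nra.
have tail_v : (1 - x ^+ 2) ^- n.+1 * expR (- (4 * n%:R * x ^+ 2)) <= v ^+ 5.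
  have -> : v ^+ 5 = expR (3 / 2 * n%:R * x ^+ 2) * expR (- (4 * n%:R * x ^+ 2)).
    by rewrite -expRM_natl -expRD; congr expR; field.
  rewrite ler_pM2r ?expR_gt0//.
  apply: (@le_trans _ _ (expR (5 / 4 * x ^+ 2) ^+ n.+1)).
    rewrite -exprVn lerXn2r ?nnegrE ?expR_ge0// ?invr_ge0; first lra.
    apply: (@le_trans _ _ (1 + 5 / 4 * x ^+ 2)); last exact: expR_ge1Dx.
    rewrite -[leLHS]mul1r ler_pdivrMr; nra.
  rewrite -expRM_natl ler_expR -natr1; nra.
apply: (le_trans _ b3); apply: (@le_trans _ _ ((n.+1 * n)%:R * v ^+ 5)).
  by rewrite ler_wpM2l.
rewrite natrM (mulrC n.+1%:R) -mulrA ler_wpM2l// -natr1.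
have -> : v ^+ 5 = v ^+ 2 * (v ^+ 2 * v) by ring.
rewrite mulrCA -[leRHS]mulr1 ler_wpM2l ?sqr_ge0// mulrA mulrDl mul1r.
have := sqr_ge0 v; nra.
Qed.

End tail_estimates.

Section truncation_cost.
Context {R : realType}.

Lemma exprn_ge1Dx2 (a : R) (n : nat) : 0 <= a ->
  1 + n%:R * a + n%:R * (n%:R - 1) / 2 * a ^+ 2 <= (1 + a) ^+ n.
Proof.
move=> a0; elim: n => [|n IH]; first by rewrite expr0; lra.
rewrite [leRHS]exprS; apply: (@le_trans _ _ ((1 + a) *
   (1 + n%:R * a + n%:R * (n%:R - 1) / 2 * a ^+ 2))); last first.
  by rewrite ler_wpM2l// addr_ge0.
have : 0 <= a ^+ 3 * (n%:R * (n%:R - 1) / 2).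
  rewrite mulr_ge0 ?exprn_ge0// divr_ge0//.
  case: n {IH} => [|n]; first by rewrite mul0r.
  by rewrite mulr_ge0// -natr1 addrK.
rewrite -(natr1 n); lra.
Qed.

Lemma ln_sqr_le (m : nat) : (81 <= m)%N -> ln m%:R ^+ 2 <= m%:R / 4 :> R.
Proof.
move=> m81; have m0 : 0 < m%:R :> R by rewrite ltr0n (leq_trans _ m81).
have u2 : Num.sqrt m%:R ^+ 2 = m%:R :> R by rewrite sqr_sqrtr// ltW.
have u9 : 9 <= Num.sqrt m%:R :> R.
  rewrite -[leLHS]ger0_norm// -sqrtr_sqr ler_sqrt ?(ltW m0)//.
  have : 81 <= m%:R :> R by rewrite ler_nat.
  lra.
have L0 : 0 <= ln m%:R :> R by rewrite ln_ge0// ler1n (leq_trans _ m81).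
have ln9 : ln 9 <= 9 / 4 :> R by apply: ln_le_of_expR => //; exact: expR_9_4_ge9.
have := ln_le_tangent (Num.sqrt m%:R : R) 9.
rewrite sqrtr_gt0 m0 ltr0n => /(_ isT isT) h.
have : ln m%:R <= Num.sqrt m%:R / 2 :> R by rewrite ln_sqrt_nat; lra.
rewrite -[X in _ <= X / 4]u2.
move: (ln m%:R) (Num.sqrt m%:R) L0 u9 => L u L0 u9 Lu; nra.
Qed.

Lemma truncation_cost_quadratic (N eta : R) : 80 <= N -> 0 < eta ->
  N * eta * (N * eta) <= N * (1 / 4) ->
  1 - eta <= (1 - 11 * eta) *
    (1 + N * (5 / 16 * eta) + N * (N - 1) / 2 * (5 / 16 * eta) ^+ 2).
Proof.
move=> N80 eta0 z2.
have K : 0 <= 5 / 16 * N + 25 / 512 * (N * eta) * (N - 1) - 10 -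
     11 * (5 / 16 * (N * eta) + 25 / 512 * (N * eta * (N * eta))).
  have : 0 <= N * eta by rewrite mulr_ge0 ?(ltW eta0)//; lra.
  move: (N * eta) z2 => z z2 z0.
  have : 0 <= z * (N - 80) by rewrite mulr_ge0 ?subr_ge0.
  lra.
have : 0 <= eta * (N * eta * eta) by rewrite !mulr_ge0 ?(ltW eta0)//; lra.
have := mulr_ge0 (ltW eta0) K; lra.
Qed.

(* [4 * expR 1 * eta] and [expR 1 / 4 * eta] are the probabilities that a trigger
   exceeds [b1] and that a redirect exceeds [b2]; the factor [4] is the asymmetry
   between the two, and [expR 1] pays for [b1 + b2] falling [2 / lam] below [Delta]. *)
Lemma truncation_cost (n : nat) (eta : R) : (80 <= n)%N -> 0 < eta < 1 ->
  n.+1%:R^-1 < (1 - eta) ^+ n.+1 ->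
  4 * expR 1 * eta < 1 /\
  (1 - eta) ^+ (n.+1 ^ 2) <=
    (1 - 4 * expR 1 * eta) ^+ n.+1 * (1 - expR 1 / 4 * eta) ^+ (n * n.+1).
Proof.
move=> n80 /andP[eta0 eta1] hm.
have n80R : 80 <= n%:R :> R by rewrite ler_nat.
have e1 := @expR1_le_11_4 R.
have mln : n.+1%:R * eta < ln n.+1%:R.
  rewrite -ltrN2 -lnV ?posrE ?ltr0n// -ltr_expR lnK ?posrE ?invr_gt0 ?ltr0n//.
  apply: (lt_le_trans hm); rewrite -mulrN expRM_natl.
  rewrite lerXn2r ?nnegrE ?expR_ge0//; first lra.
  exact: expR_ge1Dx.
have L2 : (n.+1%:R * eta) ^+ 2 <= n.+1%:R / 4.
  apply: le_trans (ln_sqr_le n.+1 _); last by rewrite ltnS.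
  have me0 : 0 < n.+1%:R * eta by rewrite mulr_gt0.
  by rewrite lerXn2r ?nnegrE ?(ltW me0) ?(ltW mln)// ltW// (lt_trans me0).
have eta18 : eta <= 1 / 18.
  move: L2; rewrite -(natr1 n); move: (n%:R) n80R => N N80 L2.
  have : (N + 1) * ((N + 1) * eta ^+ 2) <= (N + 1) * (1 / 4) by lra.
  rewrite ler_pM2l; last lra.
  move=> h; have : 81 * eta ^+ 2 <= (N + 1) * eta ^+ 2.
    by rewrite ler_wpM2r ?sqr_ge0//; lra.
  nra.
have z2 : n%:R * eta * (n%:R * eta) <= n%:R * (1 / 4).
  move: L2; rewrite -(natr1 n); move: (n%:R) n80R => N N80 L2.
  have h : (N + 1) * ((N + 1) * eta ^+ 2) <= (N + 1) * (1 / 4) by lra.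
  move: h; rewrite ler_pM2l; last lra.
  move=> h; have : N * (N * eta ^+ 2) <= N * (1 / 4).
    rewrite ler_wpM2l; [lra|lra|]; apply: (le_trans _ h).
    by rewrite ler_wpM2r ?sqr_ge0//; lra.
  lra.
split; first by nra.
have key : (1 - eta) ^+ n.+1 <= (1 - 11 * eta) * (1 - 11 / 16 * eta) ^+ n.
  have h1 : (1 - eta) * (1 + 5 / 16 * eta) <= 1 - 11 / 16 * eta by nra.
  apply: (@le_trans _ _ ((1 - 11 * eta) * ((1 - eta) * (1 + 5 / 16 * eta)) ^+ n));
    last first.
    by rewrite ler_wpM2l ?lerXn2r ?nnegrE//; nra.
  rewrite exprMn exprS mulrCA (mulrC (1 - eta)).
  rewrite ler_wpM2l ?exprn_ge0//; first lra.
  have a0 : 0 <= 5 / 16 * eta by lra.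
  have h2 := exprn_ge1Dx2 _ n a0.
  apply: (@le_trans _ _ ((1 - 11 * eta) * (1 + n%:R * (5 / 16 * eta) +
    n%:R * (n%:R - 1) / 2 * (5 / 16 * eta) ^+ 2))); last first.
    by rewrite ler_wpM2l//; lra.
  exact: truncation_cost_quadratic.
rewrite -[(n.+1 ^ 2)%N]/(n.+1 * n.+1)%N !exprM -exprMn.
rewrite lerXn2r ?nnegrE ?exprn_ge0 ?mulr_ge0 ?exprn_ge0//; [lra|nra|nra|].
apply: (le_trans key); rewrite ler_pM ?exprn_ge0//; [lra|lra|nra|].
by rewrite lerXn2r ?nnegrE//; nra.
Qed.

Lemma fact_le_expn (m : nat) : (m`! <= m ^ m)%N.
Proof.
elim: m => // m IH; rewrite factS expnS leq_mul2l/=.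
by apply: (leq_trans IH); case: m {IH} => // m; rewrite leq_exp2r.
Qed.

End truncation_cost.

(** * Deviations of the mean arrival times *)

Section pair_products.
Context {R : realType}.

Lemma prod_pair_le (I : finType) (h : R -> R) (K s : R) (k l : I) :
  k != l -> 0 <= h 0 -> h s * h (- s) <= K * (h 0 * h 0) ->
  \prod_(i : I) h (s * ((i == k)%:R - (i == l)%:R)) <= K * \prod_(i : I) h 0.
Proof.
move=> kl h0 hK.
have lk : l != k by rewrite eq_sym.
rewrite (bigD1 k)//= (bigD1 l)//=.
rewrite [in leRHS](bigD1 k)//= [in leRHS](bigD1 l)//=.
rewrite !eqxx (negbTE kl) (negbTE lk) subr0 sub0r mulr1 mulrN1.
rewrite (eq_bigr (fun=> h 0)); last first.
  by move=> i /andP[/negbTE-> /negbTE->]; rewrite subrr mulr0.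
by rewrite !mulrA ler_wpM2r ?prodr_ge0// -(mulrA K).
Qed.

Lemma truncated_mgf_pair (lam x : R) (A : set R) : 0 < lam -> 0 <= x < 1 ->
  fine (exponential_prob (lam - lam * x) A) *
    fine (exponential_prob (lam + lam * x) A) <=
    fine (exponential_prob lam A) ^+ 2 ->
  truncated_mgf lam A (lam * x) * truncated_mgf lam A (- (lam * x)) <=
  (1 - x ^+ 2)^-1 * (truncated_mgf lam A 0 * truncated_mgf lam A 0).
Proof.
move=> lam0 /andP[x0 x1] h.
have lam'0 : lam != 0 by rewrite gt_eqF.
have x1' : 1 - x != 0 by rewrite subr_eq0 gt_eqF.
have x1'' : 1 + x != 0 by rewrite gt_eqF// ltr_pwDl.
have x2 : 0 < 1 - x ^+ 2 by rewrite subr_gt0 expr_lt1.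
rewrite /truncated_mgf subr0 opprK divff// mul1r -expr2.
have -> : lam / (lam - lam * x) = (1 - x)^-1.
  by rewrite -{2}[lam]mulr1 -mulrBr invfM mulrA divff// mul1r.
have -> : lam / (lam + lam * x) = (1 + x)^-1.
  by rewrite -{2}[lam]mulr1 -mulrDr invfM mulrA divff// mul1r.
rewrite mulrACA (_ : (1 - x)^-1 * (1 + x)^-1 = (1 - x ^+ 2)^-1).
  by rewrite ler_wpM2l// invr_ge0 ltW.
by rewrite -invfM; congr _^-1; ring.
Qed.

Lemma fine_exponential_prob_setT (r : R) : 0 < r ->
  fine (exponential_prob r setT) = 1.
Proof. by move=> r0; rewrite /exponential_prob integral_exponential_pdf. Qed.

Lemma fine_exponential_prob_itv0c (r b : R) : 0 < b ->
  fine (exponential_prob r `[0, b]) = 1 - expR (- r * b).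
Proof. by move=> b0; rewrite exponential_prob_itv0c. Qed.

Lemma exponential_prob_itv0c_pair (lam x b : R) : 0 < lam -> 0 < b ->
  fine (exponential_prob (lam - lam * x) `[0, b]) *
    fine (exponential_prob (lam + lam * x) `[0, b]) <=
    fine (exponential_prob lam `[0, b]) ^+ 2.
Proof.
move=> lam0 b0; rewrite !fine_exponential_prob_itv0c//.
have -> : - (lam - lam * x) * b = - lam * b + lam * x * b by ring.
have -> : - (lam + lam * x) * b = - lam * b - lam * x * b by ring.
rewrite !expRD; set c := expR (- lam * b); set u := expR _.
have u0 : 0 < u := expR_gt0 _.
have c0 : 0 < c := expR_gt0 _.
rewrite expRN -/u.
have : 0 <= c * ((u - 1) ^+ 2 / u) by rewrite mulr_ge0 ?divr_ge0 ?sqr_ge0 ?ltW.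
have -> : (u - 1) ^+ 2 / u = u + u^-1 - 2 by field; rewrite gt_eqF.
have : c * u * (c * u^-1) = c ^+ 2 by field; rewrite gt_eqF.
lra.
Qed.

End pair_products.

Section delay_family_bigop.
Context {R : realType} {n : nat}.

Lemma big_delay_family {V : Type} {idx : V} (op : Monoid.com_law idx)
    (F : 'I_n.+1 -> V) (G : 'I_n.+1 -> 'I_n.+1 -> V) :
  \big[op/idx]_(m : msg_index n) delay_family F G m =
  op (\big[op/idx]_j F j) (\big[op/idx]_k \big[op/idx]_(j | j != k) G j k).
Proof.
rewrite big_sumType/=; congr (op _ _).
transitivity (\big[op/idx]_(p : 'I_n.+1 * 'I_n.+1 | p.1 != p.2) G p.1 p.2).
  by rewrite (big_sub [pred p : 'I_n.+1 * 'I_n.+1 | p.1 != p.2]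
    (fun p => G p.1 p.2)).
rewrite -(pair_big_dep xpredT (fun i j => i != j) (fun i j => G i j))/=.
by rewrite (exchange_big_dep xpredT).
Qed.

Lemma card_neq (k : 'I_n.+1) : #|[pred j | j != k]| = n.
Proof. by rewrite cardC1 card_ord. Qed.

Definition mean_arrival (lam : R) (dtr : 'I_n.+1 -> R)
    (dre : 'I_n.+1 -> 'I_n.+1 -> R) (k : 'I_n.+1) : R :=
  n%:R^-1 * (\sum_(j < n.+1 | j != k) redirect_arrival dtr dre j k) - 2 / lam.

Definition pair_coef (k l : 'I_n.+1) : msg_index n -> R :=
  delay_family (fun j => (j == l)%:R - (j == k)%:R)
    (fun _ i => (i == k)%:R - (i == l)%:R).

Lemma mean_arrivalB (lam : R) (dtr : 'I_n.+1 -> R)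
    (dre : 'I_n.+1 -> 'I_n.+1 -> R) (k l : 'I_n.+1) : (0 < n)%N ->
  n%:R * (mean_arrival lam dtr dre k - mean_arrival lam dtr dre l) =
  \sum_m pair_coef k l m * delay_family dtr dre m.
Proof.
move=> n0; have n0' : n%:R != 0 :> R by rewrite pnatr_eq0 -lt0n.
transitivity (\sum_(m : msg_index n) delay_family
    (fun j => ((j == l)%:R - (j == k)%:R) * dtr j)
    (fun j i => ((i == k)%:R - (i == l)%:R) * dre j i) m); last first.
  by apply: eq_bigr => -[j|p] _.
rewrite big_delay_family/=.
under [X in _ = _ + X]eq_bigr do rewrite -mulr_sumr mulrBl.
rewrite sumrB.
have sel (F : 'I_n.+1 -> R) i : \sum_j (j == i)%:R * F j = F i.
  rewrite (bigD1 i)//= eqxx mul1r big1 ?addr0// => j /negbTE->.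
  by rewrite mul0r.
under [X in _ = X + _]eq_bigr do rewrite mulrBl.
rewrite sumrB !sel /mean_arrival.
have splitk (i : 'I_n.+1) : \sum_(j < n.+1 | j != i) redirect_arrival dtr dre j i =
    \sum_j dtr j - dtr i + \sum_(j < n.+1 | j != i) dre j i.
  rewrite /redirect_arrival big_split/=; congr (_ + _).
  by rewrite [in RHS](bigD1 i)//= addrAC subrr add0r.
by rewrite !splitk; move: (2 / lam) => t; field.
Qed.

End delay_family_bigop.

Lemma bool_subr_le1 {R : realType} (i j : bool) : i%:R - j%:R <= 1 :> R.
Proof. by case: i; case: j => /=; lra. Qed.

Section pair_deviation.
Context {d} {T : measurableType d} {R : realType} (P : probability T R).
Context {n : nat} (lam : R) (D : 'I_n.+1 -> T -> R)
  (E : 'I_n.+1 -> 'I_n.+1 -> T -> R).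
Hypotheses (n0 : (0 < n)%N) (lam0 : 0 < lam).
Hypothesis mX : forall m : msg_index n, measurable_fun setT (delay_family D E m).
Hypothesis indep : mutually_independent P (delay_family D E).
Hypothesis expX : forall m : msg_index n, exp_distributed P (delay_family D E m) lam.
Variables (A1 A2 : set R).
Hypotheses (mA1 : measurable A1) (mA2 : measurable A2).

Let A : msg_index n -> set R := delay_family (fun=> A1) (fun _ _ => A2).

Definition delay_box : set T := [set w | forall m, A m (delay_family D E m w)].

Definition mean_arrival_gap (k l : 'I_n.+1) (w : T) : R :=
  mean_arrival lam (fun k => D k w) (fun j k => E j k w) k -
  mean_arrival lam (fun k => D k w) (fun j k => E j k w) l.

Let mA m : measurable (A m). Proof. by case: m. Qed.

Lemma delay_boxE :
  delay_box = \bigcap_(m in [set: msg_index n]) (delay_family D E m @^-1` A m).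
Proof.
by apply/seteqP; split => w Aw => [m _|m]; exact: Aw.
Qed.

Lemma measurable_delay_box : measurable delay_box.
Proof.
rewrite delay_boxE; apply: fin_bigcap_measurable => // m _.
by rewrite -[X in measurable X]setTI; exact: mX.
Qed.

Lemma delay_box_prob : P delay_box =
  (fine (exponential_prob lam A1) ^+ n.+1 *
   fine (exponential_prob lam A2) ^+ (n * n.+1))%:E.
Proof.
rewrite delay_boxE; transitivity (\prod_m P (delay_family D E m @^-1` A m))%E.
  exact: indep.
transitivity (\prod_(m : msg_index n) delay_family
   (fun=> fine (exponential_prob lam A1))
   (fun _ _ => fine (exponential_prob lam A2)) m)%:E.
  rewrite -prodEFin; apply: eq_bigr => -[j|p] _;
    by rewrite expX//= fineK// exponential_prob_fin_num.
rewrite big_delay_family/= prodr_const card_ord.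
under eq_bigr do rewrite prodr_const card_neq.
by rewrite prodr_const card_ord exprM.
Qed.

Hypothesis A1_pair : forall x : R, 0 <= x < 1 ->
  fine (exponential_prob (lam - lam * x) A1) *
    fine (exponential_prob (lam + lam * x) A1) <=
    fine (exponential_prob lam A1) ^+ 2.
Hypothesis A2_pair : forall x : R, 0 <= x < 1 ->
  fine (exponential_prob (lam - lam * x) A2) *
    fine (exponential_prob (lam + lam * x) A2) <=
    fine (exponential_prob lam A2) ^+ 2.

Lemma mean_arrival_gapE (k l : 'I_n.+1) (w : T) : mean_arrival_gap k l w =
  n%:R^-1 * \sum_m pair_coef k l m * delay_family D E m w.
Proof.
have n0' : n%:R != 0 :> R by rewrite pnatr_eq0 -lt0n.
apply: (mulfI n0'); rewrite mulrA divff// mul1r mean_arrivalB//.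
by apply: eq_bigr => -[j|p] _.
Qed.

Lemma measurable_mean_arrival_gap (k l : 'I_n.+1) :
  measurable_fun setT (mean_arrival_gap k l).
Proof.
rewrite (_ : mean_arrival_gap k l = fun w =>
  n%:R^-1 * \sum_m pair_coef k l m * delay_family D E m w); last first.
  by apply/funext => w; exact: mean_arrival_gapE.
apply: measurable_funM => //; apply: measurable_sum => m.
exact: measurable_funM.
Qed.

Lemma pair_deviation (k l : 'I_n.+1) : k != l ->
  (P (delay_box `&` [set w | (2 * pa_delta lam n < mean_arrival_gap k l w)%R])
   <= (fine (P delay_box) * pair_tail n)%:E)%E.
Proof.
move=> kl; have /andP[x0 x1] := @tail_ratio_bounds R n n0.
set x := tail_ratio n in x0 x1.
have x1' : x < 1 by lra.
have coef1 m : pair_coef k l m <= 1 :> R by case: m => [j|p]; exact: bool_subr_le1.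
have slam m : lam * (x * pair_coef k l m) < lam.
  rewrite -[ltRHS]mulr1 ltr_pM2l//; apply: le_lt_trans x1'.
  by rewrite -[leRHS]mulr1 ler_wpM2l.
apply: le_trans (chernoff_box P _ _ lam0 mX indep expX A _
  (4 * n%:R * x ^+ 2) _ mA slam _ _ _) _.
- apply: measurableI; first exact: measurable_delay_box.
  rewrite -[X in measurable X]setTI.
  have := measurable_fun_ltr (@measurable_cst _ _ _ _ setT (2 * pa_delta lam n))
    (measurable_mean_arrival_gap k l).
  by move=> /(_ measurableT [set true]); apply.
- by move=> w [].
- move=> w [/= _ gap].
  have -> : \sum_m lam * (x * pair_coef k l m) * delay_family D E m w =
      lam * x * n%:R * mean_arrival_gap k l w.
    rewrite mean_arrival_gapE mulrA mulfK ?pnatr_eq0 -?lt0n// mulr_sumr.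
    by apply: eq_bigr => m _; rewrite !mulrA.
  have u0 : 0 < Num.sqrt n%:R :> R by rewrite sqrtr_gt0 ltr0n.
  have -> : 4 * n%:R * x ^+ 2 = lam * x * n%:R * (2 * pa_delta lam n).
    rewrite /pa_delta (ln_tail_ratio n n0) -/x; field.
    by rewrite !gt_eqF.
  rewrite ler_wpM2l ?(ltW gap)//.
  exact: mulr_ge0 (mulr_ge0 (ltW lam0) x0) (ler0n _ _).
rewrite lee_fin /pair_tail -/x [leRHS]mulrA [leLHS]mulrC ler_wpM2r ?expR_ge0//.
pose h1 s := truncated_mgf lam A1 s; pose h2 s := truncated_mgf lam A2 s.
have K0 : 0 <= (1 - x ^+ 2)^-1 by rewrite invr_ge0 subr_ge0 expr_le1// ltW.
have tmgf0 B : truncated_mgf lam B 0 = fine (exponential_prob lam B).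
  by rewrite /truncated_mgf subr0 divff ?mul1r// gt_eqF.
have -> : \prod_m truncated_mgf lam (A m) (lam * (x * pair_coef k l m)) =
  \prod_(m : msg_index n) delay_family
    (fun j => h1 (lam * x * ((j == l)%:R - (j == k)%:R)))
    (fun _ i => h2 (lam * x * ((i == k)%:R - (i == l)%:R))) m.
  by apply: eq_bigr => -[j|p] _; rewrite mulrA.
rewrite big_delay_family/= delay_box_prob/=.
under [X in _ * X <= _]eq_bigr do rewrite prodr_const card_neq.
rewrite prodrXl.
have x01 : 0 <= x < 1 by rewrite x0.
have lk : l != k by rewrite eq_sym.
have h0 B : 0 <= truncated_mgf lam B 0 by exact: truncated_mgf_ge0.
have b1 := prod_pair_le _ h1 _ _ l k lk (h0 _)
  (truncated_mgf_pair _ _ _ lam0 x01 (A1_pair x x01)).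
have b2 := prod_pair_le _ h2 _ _ k l kl (h0 _)
  (truncated_mgf_pair _ _ _ lam0 x01 (A2_pair x x01)).
rewrite prodr_const card_ord /h1 tmgf0 in b1.
rewrite prodr_const card_ord /h2 tmgf0 in b2.
have coef_lt (i j : bool) : lam * x * (i%:R - j%:R) < lam.
  rewrite -mulrA -[ltRHS]mulr1 ltr_pM2l//; apply: le_lt_trans x1'.
  by rewrite -[leRHS]mulr1 ler_wpM2l// bool_subr_le1.
set q1 := fine _ in b1 *; set q2 := fine _ in b2 *; set K := _^-1 in K0 b1 b2.
apply: (@le_trans _ _ ((K * q1 ^+ n.+1) * (K * q2 ^+ n.+1) ^+ n)).
  apply: ler_pM => //.
  - by apply: prodr_ge0 => j _; exact: truncated_mgf_ge0.
  - by apply: exprn_ge0; apply: prodr_ge0 => j _; exact: truncated_mgf_ge0.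
  rewrite lerXn2r ?nnegrE//.
  - by apply: prodr_ge0 => j _; exact: truncated_mgf_ge0.
  - by apply: le_trans b2; apply: prodr_ge0 => j _; exact: truncated_mgf_ge0.
by rewrite -exprVn -/K !exprMn -exprM (mulnC n.+1) mulrACA -exprS mulrC.
Qed.

End pair_deviation.

(** * Correct runs *)

Section correctness.
Context {R : realType} {n : nat} (lam Delta : R).
Variables (c dtr : 'I_n.+1 -> R) (dre : 'I_n.+1 -> 'I_n.+1 -> R).
Hypotheses (n0 : (0 < n)%N) (lam0 : 0 < lam).

Let mean := mean_arrival lam dtr dre.

Lemma pa_thresholdE (k : 'I_n.+1) :
  pa_threshold lam Delta c dtr dre k =
  mean k + Delta + 2 * pa_delta lam n * k%:R.
Proof.
rewrite /pa_threshold /pa_T /mean /mean_arrival; congr (_ + _ + _).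
rewrite /local_reading big_split/= sumr_const card_neq mulrDr -[c k *+ n]mulr_natl.
rewrite [n%:R^-1 * (n%:R * _)]mulrA mulVf ?mul1r; last by rewrite pnatr_eq0 -lt0n.
lra.
Qed.

(* The action time with [delta = 0]: unlike the true one, its law does not
   depend on [k]. *)
Definition base_action (k : 'I_n.+1) : R :=
  \big[Num.max/mean k + Delta]_(j < n.+1 | j != k) redirect_arrival dtr dre j k.

Hypothesis gap : forall k l, mean k - mean l <= 2 * pa_delta lam n.

Lemma pa_delta2_ge0 : 0 <= 2 * pa_delta lam n.
Proof.
by rewrite mulr_ge0// divr_ge0 ?mulr_ge0 ?sqrtr_ge0 ?(ltW lam0)// ln_ge0// ler1n.
Qed.

Lemma pa_threshold_homo (i j : 'I_n.+1) : (i <= j)%N ->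
  pa_threshold lam Delta c dtr dre i <= pa_threshold lam Delta c dtr dre j.
Proof.
rewrite leq_eqVlt => /orP[/eqP/val_inj->//|ij].
rewrite !pa_thresholdE; have := gap i j.
have : 2 * pa_delta lam n * (i%:R + 1) <= 2 * pa_delta lam n * j%:R.
  by rewrite ler_wpM2l ?pa_delta2_ge0// natr1 ler_nat.
lra.
Qed.

Lemma pa_correct_sorted :
  (forall i j : 'I_n.+1, (i <= j)%N -> base_action i <= base_action j) ->
  pa_correct lam Delta c dtr dre.
Proof.
move=> sorted_base i j ij; apply: bigmax_le.
  exact: le_trans (pa_threshold_homo _ _ ij) (bigmax_ge_id _ _ _ _).
move=> k ki; apply: (@le_trans _ _ (base_action i)).
  exact: (le_bigmax_cond _ (fun j => redirect_arrival dtr dre j i) ki).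
apply: (le_trans (sorted_base _ _ ij)); apply: bigmax_le => [|l lj].
  apply: le_trans (bigmax_ge_id _ _ _ _).
  by rewrite pa_thresholdE lerDl mulr_ge0 ?pa_delta2_ge0.
exact: (le_bigmax_cond _ (fun k => redirect_arrival dtr dre k j) lj).
Qed.

(* All means are at least [- 2 / lam], so every threshold lies beyond the
   latest possible arrival time [b1 + b2]. *)
Lemma pa_correct_bounded (b1 b2 : R) : b1 + b2 <= Delta - 2 / lam ->
  (forall j, 0 <= dtr j <= b1) -> (forall j k, j != k -> 0 <= dre j k <= b2) ->
  pa_correct lam Delta c dtr dre.
Proof.
move=> b12 dtrb dreb i j ij; apply: bigmax_le.
  exact: le_trans (pa_threshold_homo _ _ ij) (bigmax_ge_id _ _ _ _).
move=> k ki; apply: le_trans (bigmax_ge_id _ _ _ _).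
apply: (@le_trans _ _ (b1 + b2)).
  by have /andP[_ ?] := dtrb k; have /andP[_ ?] := dreb _ _ ki; exact: lerD.
rewrite pa_thresholdE.
have : 0 <= 2 * pa_delta lam n * j%:R by rewrite mulr_ge0 ?pa_delta2_ge0.
have : 0 <= n%:R^-1 * (\sum_(l < n.+1 | l != j) redirect_arrival dtr dre l j).
  rewrite mulr_ge0// sumr_ge0// => l lj.
  have /andP[? _] := dtrb l; have /andP[? _] := dreb _ _ lj; exact: addr_ge0.
rewrite /mean /mean_arrival; lra.
Qed.

End correctness.

(** * Exchangeability of the workers *)

Section measurable_families.
Context {d} {T : measurableType d} {R : realType}.

Lemma measurable_bigmax {J : Type} (r : seq J) (Q : pred J) (f0 : T -> R)
    (F : J -> T -> R) :
  measurable_fun setT f0 -> (forall j, measurable_fun setT (F j)) ->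
  measurable_fun setT (fun w => \big[Num.max/f0 w]_(j <- r | Q j) F j w).
Proof.
move=> mf0 mF; elim: r => [|j r IH].
  by under eq_fun do rewrite big_nil.
under eq_fun do rewrite big_cons.
by case: (Q j) => //; exact: measurable_maxr.
Qed.

Lemma measurable_forall_ler {J : finType} (Q : pred J) (f g : J -> T -> R) :
  (forall j, measurable_fun setT (f j)) -> (forall j, measurable_fun setT (g j)) ->
  measurable [set w | forall j, Q j -> f j w <= g j w].
Proof.
move=> mf mg.
rewrite (_ : mkset _ = \bigcap_(j in [set j | Q j]) [set w | f j w <= g j w]).
  apply: fin_bigcap_measurable => // j _.
  rewrite -[X in measurable X]setTI.
  have := measurable_fun_ler (mf j) (mg j).
  by move=> /(_ measurableT [set true]); apply.
by apply/seteqP; split => w h j; exact: h.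
Qed.

End measurable_families.

Definition real_family (R : realType) (I : finType) : Type := I -> R.

HB.instance Definition _ (R : realType) (I : finType) :=
  Choice.copy (real_family R I) (I -> R).
HB.instance Definition _ (R : realType) (I : finType) :=
  isPointed.Build (real_family R I) (fun=> 0).

Definition family_boxes (R : realType) (I : finType) : set (set (real_family R I)) :=
  [set C | exists2 B : I -> set R, (forall i, measurable (B i)) &
                              C = [set v | forall i, B i (v i)]].

Section identical_laws.
Context {d} {T : measurableType d} {R : realType} (P : probability T R).
Context {I : finType}.

Local Notation family_space := (g_sigma_algebraType (family_boxes R I)).

Lemma measurable_family_eval (i : I) :
  measurable_fun setT (fun v : family_space => v i : R).
Proof.
move=> _ B mB; rewrite setTI; apply: sub_sigma_algebra.
exists (fun j => if j == i then B else setT); first by move=> j; case: ifP.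
apply/seteqP; split => [v Bv j|v /(_ i)]; last by rewrite eqxx.
by case: eqVneq => [->|].
Qed.

Lemma measurable_family (X : I -> T -> R) :
  (forall i, measurable_fun setT (X i)) ->
  measurable_fun setT (fun w => (fun i => X i w) : family_space).
Proof.
move=> mX; apply: (@measurability _ _ _ family_space setT _ (family_boxes R I)) => //.
move=> _ [C [B mB ->] <-].
rewrite setTI (_ : _ @^-1` _ = \bigcap_(i in [set: I]) (X i @^-1` B i)).
  apply: fin_bigcap_measurable => // i _.
  by rewrite -[X in measurable X]setTI; exact: mX.
by apply/seteqP; split => w Bw => [i _|i]; exact: Bw.
Qed.

Lemma mutually_independent_same_law (X Y : I -> T -> R) (C : set family_space) :
  (forall i, measurable_fun setT (X i)) -> (forall i, measurable_fun setT (Y i)) ->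
  mutually_independent P X -> mutually_independent P Y ->
  (forall i B, measurable B -> P (X i @^-1` B) = P (Y i @^-1` B)) ->
  measurable C ->
  P [set w | C (fun i => X i w)] = P [set w | C (fun i => Y i w)].
Proof.
move=> mX mY iX iY XY mC.
pose fX : T -> family_space := fun w i => X i w.
pose fY : T -> family_space := fun w i => Y i w.
have mfX : measurable_fun setT fX by exact: measurable_family.
have mfY : measurable_fun setT fY by exact: measurable_family.
pose X' : {mfun T >-> family_space} := HB.pack fX (isMeasurableFun.Build _ _ _ _ _ mfX).
pose Y' : {mfun T >-> family_space} := HB.pack fY (isMeasurableFun.Build _ _ _ _ _ mfY).
suff : distribution P X' C = distribution P Y' C by [].
apply: (@measure_unique _ _ family_space (family_boxes R I) (fun=> setT)) => //.
- move=> _ _ [B1 mB1 ->] [B2 mB2 ->]; exists (fun i => B1 i `&` B2 i).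
    by move=> i; exact: measurableI.
  by apply/seteqP; split=> v => [[h1 h2] i|h]; [split|split=> i; have [] := h i].
- move=> _; exists (fun=> setT) => //.
  by apply/seteqP; split.
- by rewrite bigcup_const.
- move=> _ [B mB ->].
  have boxE (Z : I -> T -> R) : mutually_independent P Z ->
      P [set w | forall i, B i (Z i w)] = (\prod_i P (Z i @^-1` B i))%E.
    move=> iZ; rewrite -iZ//; congr (P _).
    by apply/seteqP; split => w Bw => [i _|i]; exact: Bw.
  rewrite -[LHS]/(P [set w | forall i, B i (X i w)]).
  rewrite -[RHS]/(P [set w | forall i, B i (Y i w)]) !boxE//.
  by apply: eq_bigr => i _; exact: XY.
- by move=> _; rewrite /= /distribution /pushforward preimage_setT probability_setT ltry.
Qed.

Lemma mutually_independent_reindex (X : I -> T -> R) (s : I -> I) :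
  injective s -> mutually_independent P X ->
  mutually_independent P (fun i => X (s i)).
Proof.
move=> s_inj iX B mB.
have sK := f_finv s_inj; have Ks := finv_f s_inj.
transitivity (P (\bigcap_(i in [set: I]) (X i @^-1` B (finv s i)))).
  congr (P _); apply/seteqP; split => w Bw i _.
    by have := Bw (finv s i) Logic.I; rewrite /= sK.
  by have := Bw (s i) Logic.I; rewrite /= Ks.
rewrite iX// (reindex_inj s_inj)/=.
by apply: eq_bigr => i _; rewrite Ks.
Qed.

End identical_laws.

Lemma exists_sorting_perm {R : realType} {m : nat} (f : 'I_m -> R) :
  exists s : 'S_m, forall i j : 'I_m, (i <= j)%N -> f (s i) <= f (s j).
Proof.
pose r : rel 'I_m := fun i j => f i <= f j.
have r_total : total r by move=> i j; exact: le_total.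
have r_trans : transitive r by move=> j i k; exact: le_trans.
have /tuple_permP[s sE] : perm_eq (sort_tuple r (ord_tuple m)) (ord_tuple m).
  by rewrite perm_sort.
exists s => i j ij.
have := sort_sorted r_total (ord_tuple m).
move/(sorted_leq_nth r_trans (fun i => lexx (f i))) => /(_ i).
have nthE (k : 'I_m) : nth i (sort r (ord_tuple m)) k = s k.
  rewrite -[sort r _]/(tval (sort_tuple r (ord_tuple m))) sE.
  by rewrite -(tnth_nth i) tnth_mktuple tnth_ord_tuple.
move=> /(_ i j); rewrite !nthE; apply => //.
  by rewrite inE size_sort size_tuple.
by rewrite inE size_sort size_tuple.
Qed.

Lemma measure_le_sum {d} {T : measurableType d} {R : realType}
    (mu : {measure set T -> \bar R}) (J : finType) (Q : pred J) (A : set T)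
    (B : J -> set T) :
  measurable A -> (forall j, measurable (B j)) ->
  (forall w, A w -> exists2 j, Q j & B j w) ->
  (mu A <= \sum_(j | Q j) mu (B j))%E.
Proof.
move=> mA mB AB.
have mU (r : seq J) : measurable (\big[setU/set0]_(j <- r | Q j) B j).
  by apply: bigsetU_measurable.
apply: (@le_trans _ _ (mu (\big[setU/set0]_(j | Q j) B j))).
  apply: le_measure; rewrite ?inE// => w /AB[j Qj Bjw].
  by rewrite -bigcup_seq_cond; exists j => //=; rewrite mem_index_enum.
elim: (index_enum J) => [|j r IH]; first by rewrite !big_nil measure0.
rewrite !big_cons; case: ifP => // _.
apply: le_trans (measureU2 _ _ _) _ => //.
exact: leeD2l.
Qed.

Section permuted_delays.
Context {R : realType} {n : nat}.

(* The value [0] on the diagonal is junk: no worker sends to itself. *)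
Definition redirect_of (v : msg_index n -> R) (j k : 'I_n.+1) : R :=
  if insub (j, k) is Some p then v (inr p) else 0.

Lemma redirect_of_delay (dtr : 'I_n.+1 -> R) (dre : 'I_n.+1 -> 'I_n.+1 -> R)
    (j k : 'I_n.+1) : j != k -> redirect_of (delay_family dtr dre) j k = dre j k.
Proof. by move=> jk; rewrite /redirect_of insubT. Qed.

Lemma permute_neq (s : {perm 'I_n.+1}) (p : {p : 'I_n.+1 * 'I_n.+1 | p.1 != p.2}) :
  (s (val p).1, s (val p).2).1 != (s (val p).1, s (val p).2).2.
Proof. by rewrite /= (inj_eq perm_inj) (valP p). Qed.

Definition permute_msg (s : {perm 'I_n.+1}) (m : msg_index n) : msg_index n :=
  match m with
  | inl k => inl (s k)
  | inr p => inr (exist (fun q : 'I_n.+1 * 'I_n.+1 => is_true (q.1 != q.2))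
      (s (val p).1, s (val p).2) (permute_neq s p))
  end.

Lemma permute_msg_inj (s : {perm 'I_n.+1}) : injective (permute_msg s).
Proof.
move=> [j|p] [k|q] //= []; first by move=> /perm_inj->.
move: p q => [[a b] p] [[a' b'] q] /= /perm_inj aa' /perm_inj bb'.
by congr inr; apply/val_inj; rewrite /= aa' bb'.
Qed.

Lemma redirect_of_permute (v : msg_index n -> R) (s : {perm 'I_n.+1}) (j k : 'I_n.+1) :
  redirect_of (fun m => v (permute_msg s m)) j k = redirect_of v (s j) (s k).
Proof.
rewrite /redirect_of; have [->|jk] := eqVneq j k.
  by rewrite !insubN//= ?eqxx.
have sjk : s j != s k by rewrite (inj_eq perm_inj).
by rewrite !insubT/=; congr (v (inr _)); exact/val_inj.
Qed.

Variables (lam Delta : R).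

Definition mean_of (v : msg_index n -> R) : 'I_n.+1 -> R :=
  mean_arrival lam (fun k => v (inl k)) (redirect_of v).

Definition base_of (v : msg_index n -> R) : 'I_n.+1 -> R :=
  base_action lam Delta (fun k => v (inl k)) (redirect_of v).

Lemma mean_of_permute (v : msg_index n -> R) (s : {perm 'I_n.+1}) (k : 'I_n.+1) :
  mean_of (fun m => v (permute_msg s m)) k = mean_of v (s k).
Proof.
rewrite /mean_of /mean_arrival; congr (_ * _ - _).
rewrite [RHS](reindex_inj (@perm_inj _ s)); apply: eq_big => [j|j _].
  by rewrite (inj_eq perm_inj).
by rewrite /redirect_arrival redirect_of_permute.
Qed.

Lemma base_of_permute (v : msg_index n -> R) (s : {perm 'I_n.+1}) (k : 'I_n.+1) :
  base_of (fun m => v (permute_msg s m)) k = base_of v (s k).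
Proof.
rewrite /base_of /base_action; have := mean_of_permute v s k; rewrite /mean_of => ->.
rewrite [RHS](reindex_inj (@perm_inj _ s)); apply: eq_big => [j|j _].
  by rewrite (inj_eq perm_inj).
by rewrite /redirect_arrival redirect_of_permute.
Qed.

Lemma mean_of_delay (dtr : 'I_n.+1 -> R) (dre : 'I_n.+1 -> 'I_n.+1 -> R) :
  mean_of (delay_family dtr dre) =1 mean_arrival lam dtr dre.
Proof.
move=> k; rewrite /mean_of /mean_arrival; congr (_ * _ - _).
by apply: eq_bigr => j jk; rewrite /redirect_arrival redirect_of_delay.
Qed.

Lemma base_of_delay (dtr : 'I_n.+1 -> R) (dre : 'I_n.+1 -> 'I_n.+1 -> R) :
  base_of (delay_family dtr dre) =1 base_action lam Delta dtr dre.
Proof.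
move=> k; rewrite /base_of /base_action.
have := mean_of_delay dtr dre k; rewrite /mean_of => ->.
by apply: eq_bigr => j jk; rewrite /redirect_arrival redirect_of_delay.
Qed.

Local Notation family_space := (g_sigma_algebraType (family_boxes R (msg_index n))).

Lemma measurable_arrival_of (j k : 'I_n.+1) :
  measurable_fun setT (fun v : family_space =>
    redirect_arrival (fun k => v (inl k)) (redirect_of v) j k : R).
Proof.
apply: measurable_funD; first exact: measurable_family_eval.
rewrite /redirect_of; case: insub => [p|]; last exact: measurable_cst.
exact: measurable_family_eval.
Qed.

Lemma measurable_mean_of (k : 'I_n.+1) :
  measurable_fun setT (fun v : family_space => mean_of v k : R).
Proof.
apply: measurable_funB => //; apply: measurable_funM => //.
under eq_fun do rewrite -big_filter.
by apply: measurable_sum => j; exact: measurable_arrival_of.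
Qed.

Lemma measurable_base_of (k : 'I_n.+1) :
  measurable_fun setT (fun v : family_space => base_of v k : R).
Proof.
apply: measurable_bigmax => [|j]; last exact: measurable_arrival_of.
by apply: measurable_funD => //; exact: measurable_mean_of.
Qed.

Definition close_means : set (msg_index n -> R) :=
  [set v | forall p : 'I_n.+1 * 'I_n.+1,
             mean_of v p.1 - mean_of v p.2 <= 2 * pa_delta lam n].

Definition sorted_by (s : {perm 'I_n.+1}) : set (msg_index n -> R) :=
  [set v | forall p : 'I_n.+1 * 'I_n.+1,
             (p.1 <= p.2)%N -> base_of v (s p.1) <= base_of v (s p.2)].

Lemma measurable_close_means : measurable (close_means : set family_space).
Proof.
have := @measurable_forall_ler _ family_space R ('I_n.+1 * 'I_n.+1)%type xpredT
  (fun p v => mean_of v p.1 - mean_of v p.2) (fun _ _ => 2 * pa_delta lam n).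
rewrite (_ : mkset _ = close_means); first apply => //.
  by move=> p; apply: measurable_funB; exact: measurable_mean_of.
by apply/seteqP; split => v h p; [exact: h|move=> _; exact: h].
Qed.

Lemma measurable_sorted_by (s : {perm 'I_n.+1}) :
  measurable (sorted_by s : set family_space).
Proof.
by apply: (@measurable_forall_ler _ family_space R ('I_n.+1 * 'I_n.+1)%type
  (fun p => (p.1 <= p.2)%N) (fun p v => base_of v (s p.1))
  (fun p v => base_of v (s p.2))) => p; exact: measurable_base_of.
Qed.

Context {d} {T : measurableType d} (P : probability T R).
Variable X : msg_index n -> T -> R.
Hypothesis mX : forall m, measurable_fun setT (X m).
Hypothesis indep : mutually_independent P X.
Hypothesis expX : forall m, exp_distributed P (X m) lam.

Local Notation vec w := (fun m => X m w).

Lemma measurable_vec (C : set family_space) : measurable C ->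
  measurable [set w | C (vec w)].
Proof.
move=> mC; have := measurable_family X mX.
by move=> /(_ measurableT C mC); rewrite setTI.
Qed.

Lemma sorted_exchange (s : {perm 'I_n.+1}) :
  P [set w | (close_means `&` sorted_by s) (vec w)] =
  P [set w | (close_means `&` sorted_by 1%g) (vec w)].
Proof.
rewrite [RHS](@mutually_independent_same_law _ _ _ P _ X
  (fun m => X (permute_msg s m)) (close_means `&` sorted_by 1%g))//.
- congr (P _); apply/seteqP; split => w [cw sw]; split => p.
  + by rewrite !(mean_of_permute (vec w) s); exact: (cw (s p.1, s p.2)).
  + by move=> pp; rewrite !perm1 !(base_of_permute (vec w) s); exact: sw.
  + have := cw ((s^-1)%g p.1, (s^-1)%g p.2).
    by rewrite /= !(mean_of_permute (vec w) s) !permKV.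
  + by move=> pp; have := sw p pp; rewrite !perm1 !(base_of_permute (vec w) s).
- exact: mutually_independent_reindex (@permute_msg_inj s) indep.
- by move=> m B mB; rewrite !expX.
- apply: measurableI; first exact: measurable_close_means.
  exact: measurable_sorted_by.
Qed.

Lemma sorted_prob :
  (P [set w | close_means (vec w)] <=
   (n.+1`!%:R)%:E * P [set w | (close_means `&` sorted_by 1%g) (vec w)])%E.
Proof.
have mC s : measurable [set w | (close_means `&` sorted_by s) (vec w)].
  apply: measurable_vec; apply: measurableI; first exact: measurable_close_means.
  exact: measurable_sorted_by.
apply: (@le_trans _ _ (\sum_(s : {perm 'I_n.+1})
    P [set w | (close_means `&` sorted_by s) (vec w)])%E).
  apply: measure_le_sum => //.
    exact: measurable_vec measurable_close_means.
  move=> w cw; have [s sP] := exists_sorting_perm (base_of (vec w)).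
  by exists s => //; split => // p; exact: sP.
under eq_bigr do rewrite sorted_exchange.
rewrite -(fineK (fin_num_measure P _ (mC 1%g))) sumEFin sumr_const card_Sn.
by rewrite -EFinM mulr_natl.
Qed.

End permuted_delays.

(** * Probability of a correct run *)

Lemma sum_neq_pairs {R : realType} (n : nat) (a : R) :
  \sum_(p : 'I_n.+1 * 'I_n.+1 | p.1 != p.2) a = (n.+1 * n)%:R * a.
Proof.
rewrite -(pair_big_dep xpredT (fun i j : 'I_n.+1 => i != j) (fun _ _ => a))/=.
under eq_bigr => i _ do (rewrite (eq_bigl (fun j => j != i)) ?sumr_const ?card_neq;
  last by move=> j; rewrite eq_sym).
by rewrite sumr_const card_ord -mulrnA mulnC mulr_natl.
Qed.

Section close_means_prob.
Context {d} {T : measurableType d} {R : realType} (P : probability T R).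
Context {n : nat} (lam : R) (D : 'I_n.+1 -> T -> R)
  (E : 'I_n.+1 -> 'I_n.+1 -> T -> R).
Hypotheses (n0 : (0 < n)%N) (lam0 : 0 < lam).
Hypothesis mX : forall m : msg_index n, measurable_fun setT (delay_family D E m).
Hypothesis indep : mutually_independent P (delay_family D E).
Hypothesis expX : forall m : msg_index n, exp_distributed P (delay_family D E m) lam.
Variables (A1 A2 : set R).
Hypotheses (mA1 : measurable A1) (mA2 : measurable A2).
Hypothesis A1_pair : forall x : R, 0 <= x < 1 ->
  fine (exponential_prob (lam - lam * x) A1) *
    fine (exponential_prob (lam + lam * x) A1) <=
    fine (exponential_prob lam A1) ^+ 2.
Hypothesis A2_pair : forall x : R, 0 <= x < 1 ->
  fine (exponential_prob (lam - lam * x) A2) *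
    fine (exponential_prob (lam + lam * x) A2) <=
    fine (exponential_prob lam A2) ^+ 2.
Hypothesis Psi0 : 0 < Psi R n.

Definition close_run : set T := [set w | forall p : 'I_n.+1 * 'I_n.+1,
  mean_arrival_gap lam D E p.1 p.2 w <= 2 * pa_delta lam n].

Lemma measurable_close_run : measurable close_run.
Proof.
have := @measurable_forall_ler _ T R ('I_n.+1 * 'I_n.+1)%type xpredT
  (fun p w => mean_arrival_gap lam D E p.1 p.2 w) (fun _ _ => 2 * pa_delta lam n).
rewrite (_ : mkset _ = close_run); first apply => //.
  by move=> p; exact: measurable_mean_arrival_gap.
by apply/seteqP; split => w h p; [exact: h|move=> _; exact: h].
Qed.

Lemma close_run_prob : ((fine (P (delay_box D E A1 A2)) * Psi R n)%:E <=
  P (delay_box D E A1 A2 `&` close_run))%E.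
Proof.
set box := delay_box D E A1 A2.
have mbox : measurable box by exact: measurable_delay_box.
have mclose := measurable_close_run.
pose far (p : 'I_n.+1 * 'I_n.+1) : set T :=
  [set w | (2 * pa_delta lam n < mean_arrival_gap lam D E p.1 p.2 w)%R].
have mfar p : measurable (box `&` far p).
  apply: measurableI => //; rewrite -[X in measurable X]setTI.
  have := measurable_fun_ltr (@measurable_cst _ _ _ _ setT (2 * pa_delta lam n))
    (measurable_mean_arrival_gap lam D E n0 mX p.1 p.2).
  by move=> /(_ measurableT [set true]); apply.
have far_le : (P (box `&` ~` close_run) <=
    ((n.+1 * n)%:R * (fine (P box) * pair_tail n))%:E)%E.
  apply: (@le_trans _ _ (\sum_(p : 'I_n.+1 * 'I_n.+1 | p.1 != p.2)
      P (box `&` far p))%E).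
    apply: measure_le_sum => //; first exact: measurableI (measurableC _).
    move=> w [bw]; move=> /existsNP[p /negP]; rewrite -ltNge => pw.
    exists p => //; apply: contraTN pw => /eqP ->.
    by rewrite -leNgt /mean_arrival_gap subrr pa_delta2_ge0.
  apply: (@le_trans _ _ (\sum_(p : 'I_n.+1 * 'I_n.+1 | p.1 != p.2)
      (fine (P box) * pair_tail n)%:E)%E).
    by apply: lee_sum => p pp; exact: pair_deviation.
  by rewrite sumEFin lee_fin sum_neq_pairs.
have := @measureU2 _ _ _ P (box `&` close_run) (box `&` ~` close_run)
  (measurableI _ _ mbox mclose) (measurableI _ _ mbox (measurableC mclose)).
rewrite -setIUr setUv setIT => h.
have h' := le_trans h (leeD2l _ far_le).
have mbc : measurable (box `&` close_run) by exact: measurableI.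
have h'' : fine (P box) <= fine (P (box `&` close_run)) +
    (n.+1 * n)%:R * (fine (P box) * pair_tail n).
  by rewrite -lee_fin EFinD !fineK ?fin_num_measure.
rewrite -[leRHS]fineK ?fin_num_measure// lee_fin.
have tail := @pair_tail_le R n n0 Psi0.
have pb0 : 0 <= fine (P box) by rewrite fine_ge0.
have {tail} : fine (P box) * ((n.+1 * n)%:R * pair_tail n) <=
  fine (P box) * (1 - Psi R n) by exact: ler_wpM2l.
lra.
Qed.

End close_means_prob.

Section measurable_correctness.
Context {d} {T : measurableType d} {R : realType}.

Lemma measurable_pa_correct {n : nat} (lam Delta : R) (c : 'I_n.+1 -> R)
    (D : 'I_n.+1 -> T -> R) (E : 'I_n.+1 -> 'I_n.+1 -> T -> R) : (0 < n)%N ->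
  (forall k, measurable_fun setT (D k)) ->
  (forall j k, measurable_fun setT (E j k)) ->
  measurable [set w | pa_correct lam Delta c (fun k => D k w) (fun j k => E j k w)].
Proof.
move=> n0 mD mE.
have marr j k : measurable_fun setT (fun w =>
  redirect_arrival (fun k => D k w) (fun j k => E j k w) j k).
  exact: measurable_funD.
have mt k : measurable_fun setT (fun w =>
    action_time lam Delta c (fun k => D k w) (fun j k => E j k w) k).
  apply: measurable_bigmax => // ; under eq_fun do rewrite pa_thresholdE//.
  do 2!apply: measurable_funD => //; apply: measurable_funB => //.
  apply: measurable_funM => //; under eq_fun do rewrite -big_filter.
  exact: measurable_sum.
have := @measurable_forall_ler _ T R ('I_n.+1 * 'I_n.+1)%type
  (fun p => (p.1 <= p.2)%N) (fun p w => action_time lam Delta c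
     (fun k => D k w) (fun j k => E j k w) p.1) (fun p w => action_time lam Delta c
     (fun k => D k w) (fun j k => E j k w) p.2).
rewrite (_ : mkset _ = [set w | pa_correct lam Delta c (fun k => D k w)
   (fun j k => E j k w)]); first by apply.
apply/seteqP; split => w h; first by move=> i j ij; exact: (h (i, j)).
by move=> [i j]; exact: h.
Qed.

End measurable_correctness.

Section run_probability.
Context {d} {T : measurableType d} {R : realType} (P : probability T R).
Context {n : nat} (lam Delta : R) (c : 'I_n.+1 -> R) (D : 'I_n.+1 -> T -> R)
  (E : 'I_n.+1 -> 'I_n.+1 -> T -> R).
Hypotheses (n0 : (0 < n)%N) (lam0 : 0 < lam) (Delta0 : 0 < Delta).
Hypothesis mD : forall k, measurable_fun setT (D k).
Hypothesis mE : forall j k, measurable_fun setT (E j k).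
Hypothesis indep : mutually_independent P (delay_family D E).
Hypothesis expX : forall m : msg_index n, exp_distributed P (delay_family D E m) lam.
Hypothesis Psi0 : 0 < Psi R n.

Let correct : set T :=
  [set w | pa_correct lam Delta c (fun k => D k w) (fun j k => E j k w)].

Let mX (m : msg_index n) : measurable_fun setT (delay_family D E m).
Proof. by case: m => [k|p]; [exact: mD|exact: mE]. Qed.

Let delay_familyE (w : T) :
  (fun m : msg_index n => delay_family D E m w) =
  delay_family (fun k => D k w) (fun j k => E j k w).
Proof. by apply/funext => -[j|p]. Qed.

Let setT_pair (x : R) : 0 <= x < 1 ->
  fine (exponential_prob (lam - lam * x) setT) *
    fine (exponential_prob (lam + lam * x) setT) <=
    fine (exponential_prob lam setT) ^+ 2.
Proof.
move=> /andP[x0 x1]; rewrite !fine_exponential_prob_setT ?expr1n ?mulr1//.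
  by rewrite ltr_wpDr ?mulr_ge0 ?(ltW lam0).
by rewrite subr_gt0 -[ltRHS]mulr1 ltr_pM2l.
Qed.

Lemma correct_prob_sorted :
  ((Psi R n / n.+1`!%:R)%:E <= P correct)%E.
Proof.
have mcorrect : measurable correct by exact: measurable_pa_correct.
have mcs : measurable [set w | (close_means lam `&` sorted_by lam Delta 1%g)
    (fun m : msg_index n => delay_family D E m w)].
  apply: measurable_vec => //; apply: measurableI.
    exact: measurable_close_means.
  exact: measurable_sorted_by.
have h : ((Psi R n)%:E <= (n.+1`!%:R)%:E * P correct)%E.
  apply: le_trans (le_trans (sorted_prob lam Delta P _ mX indep expX) _); last first.
    rewrite lee_wpmul2l ?lee_fin//; apply: le_measure; rewrite ?inE// => w.
    rewrite /= delay_familyE => -[cw sw]; apply: pa_correct_sorted => //.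
      by move=> k l; have := cw (k, l); rewrite !mean_of_delay.
    by move=> i j ij; have := sw (i, j) ij; rewrite !perm1 !base_of_delay.
  have := @close_run_prob _ _ _ P n lam D E n0 lam0 mX indep expX setT setT
    measurableT measurableT setT_pair setT_pair Psi0.
  rewrite (delay_box_prob P lam _ _ lam0 indep expX _ _ measurableT measurableT)/=.
  rewrite fine_exponential_prob_setT// !expr1n !mul1r => /le_trans; apply.
  apply: le_measure; rewrite ?inE.
  - apply: measurableI; first exact: measurable_delay_box.
    exact: measurable_close_run.
  - exact: measurable_vec (measurable_close_means lam).
  - by move=> w [_ cw] p; rewrite delay_familyE !mean_of_delay; exact: cw.
by rewrite mulrC EFinM lee_pdivrMl ?ltr0n ?fact_gt0.
Qed.

Lemma correct_prob_bounded (b1 b2 : R) : 0 < b1 -> 0 < b2 ->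
  b1 + b2 <= Delta - 2 / lam ->
  (((1 - expR (- lam * b1)) ^+ n.+1 * (1 - expR (- lam * b2)) ^+ (n * n.+1) *
    Psi R n)%:E <= P correct)%E.
Proof.
move=> b10 b20 b12.
have mcorrect : measurable correct by exact: measurable_pa_correct.
have mI b : measurable `[0, b : R]%classic by exact: measurable_itv.
have := @close_run_prob _ _ _ P n lam D E n0 lam0 mX indep expX `[0, b1] `[0, b2]
  (mI _) (mI _) (fun x _ => exponential_prob_itv0c_pair _ x _ lam0 b10)
  (fun x _ => exponential_prob_itv0c_pair _ x _ lam0 b20) Psi0.
rewrite (delay_box_prob P lam _ _ lam0 indep expX _ _ (mI _) (mI _))/=.
rewrite !fine_exponential_prob_itv0c// => /le_trans; apply.
apply: le_measure; rewrite ?inE//.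
  apply: measurableI; first exact: measurable_delay_box.
  exact: measurable_close_run.
move=> w [bw cw]; apply: (@pa_correct_bounded _ _ _ _ _ _ _ n0 lam0 _ b1 b2) => //.
- by move=> k l; exact: cw (k, l).
- by move=> j; have := bw (inl j); rewrite /= in_itv.
- move=> j k jk; have := bw (inr (exist (fun p => is_true (p.1 != p.2)) (j, k) jk)).
  by rewrite /= in_itv.
Qed.

Lemma correct_prob (eta := expR (- (2^-1 * lam * Delta))) :
  ((Psi R n * (1 - eta) ^+ (n.+1 ^ 2))%:E <= P correct)%E.
Proof.
have n80 := Psi_gt0_ge80 _ n0 Psi0.
have eta0 : 0 < eta := expR_gt0 _.
have eta1 : eta < 1.
  by rewrite /eta expR_lt1 oppr_lt0 !mulr_gt0 ?invr_gt0.
have [small|large] := leP ((1 - eta) ^+ n.+1) n.+1%:R^-1.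
  apply: le_trans correct_prob_sorted; rewrite lee_fin ler_pM2l//.
  apply: (@le_trans _ _ (n.+1%:R^-1 ^+ n.+1)).
    rewrite -[(n.+1 ^ 2)%N]/(n.+1 * n.+1)%N exprM.
    by rewrite lerXn2r ?nnegrE ?exprn_ge0 ?invr_ge0// subr_ge0 ltW.
  rewrite exprVn lef_pV2 ?posrE ?exprn_gt0 ?ltr0n ?fact_gt0//.
  by rewrite -natrX ler_nat fact_le_expn.
have [e4 cost] := @truncation_cost R n eta n80 (introT andP (conj eta0 eta1)) large.
pose b1 := Delta / 2 - (1 + ln 4) / lam; pose b2 := Delta / 2 - (1 - ln 4) / lam.
have lam'0 : lam != 0 by rewrite gt_eqF.
have e4' : expR (ln 4) = 4 :> R by rewrite lnK ?posrE.
have E1 : expR (- lam * b1) = 4 * expR 1 * eta.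
  rewrite (_ : - lam * b1 = ln 4 + 1 - 2^-1 * lam * Delta).
    by rewrite !expRD e4'.
  by rewrite /b1; field.
have E2 : expR (- lam * b2) = expR 1 / 4 * eta.
  rewrite (_ : - lam * b2 = 1 - ln 4 - 2^-1 * lam * Delta).
    by rewrite !expRD expRN e4'.
  by rewrite /b2; field.
have b10 : 0 < b1.
  by move: e4; rewrite -E1 expR_lt1 mulNr oppr_lt0 pmulr_rgt0.
have b12 : b1 < b2.
  rewrite /b1 /b2 ltrD2l ltrN2 ltr_pM2r ?invr_gt0// ltrD2l.
  have : 0 < ln 4 :> R by rewrite ln_gt0// ltr1n.
  lra.
apply: le_trans (correct_prob_bounded _ _ b10 (lt_trans b10 b12) _).
  by rewrite lee_fin mulrC ler_wpM2r ?(ltW Psi0)// E1 E2.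
by rewrite /b1 /b2 le_eqVlt; apply/orP; left; apply/eqP; field.
Qed.

End run_probability.

Theorem theorem6 (R : realType) (d : measure_display) (T : measurableType d)
    (P : probability T R) (n : nat) (lam Delta : R)
    (c : 'I_n.+1 -> R)
    (D : 'I_n.+1 -> {RV P >-> R}) (E : 'I_n.+1 -> 'I_n.+1 -> {RV P >-> R}) :
  (1 <= n)%N -> 0 < lam -> 0 < Delta ->
  (forall k, exp_distributed P (D k) lam) ->
  (forall j k, j != k -> exp_distributed P (E j k) lam) ->
  mutually_independent P
    (delay_family (fun k => (D k : T -> R)) (fun j k => (E j k : T -> R))) ->
  ((Psi R n * (1 - expR (- (2^-1 * lam * Delta))) ^+ ((n.+1) ^ 2))%:E
     <= P [set w | @pa_correct R n lam Delta c
                     (fun k => D k w) (fun j k => E j k w)])%E.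
Proof.
move=> n1 lam0 Delta0 expD expE indep.
have [Psi0|Psi_le0] := ltP 0 (Psi R n).
  apply: (correct_prob P lam Delta c _ _ n1 lam0 Delta0) => //.
  by case=> [k|[[j k] jk]] /=; [exact: expD|exact: expE].
have -> : Psi R n = 0 by apply/eqP; rewrite eq_le Psi_le0 le_max lexx.
by rewrite mul0r.
Qed.
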